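(* Let $\mathcal L=\mathbb C^d$, let the data set $(B_1,B_2,C_1,C_2,K)$ satisfy $$K(B_2h,B_1g)-K(B_1h,B_2g)=(C_1h,C_2g)_{\mathbb C^d}-(C_2h,C_1g)_{\mathbb C^d}\qquad(h,g\in\mathcal X),$$ and let $\operatorname{ran} C_2=\mathcal L=\mathbb C^d$. Then Problem $AIP(B_1,B_2,C_1,C_2,K)$ in the class $N^{d\times d}$ is solvable, and the set of its solutions $m$ is parametrized by the formula $$\begin{bmatrix} m(\lambda)\\ I_d\end{bmatrix}=\begin{bmatrix} I_d&0\\ \lambda I_d& I_d\end{bmatrix}\begin{bmatrix}P_{\mathcal L}(\widetilde A-\lambda)^{-1}|_{\mathcal L}\\ I_{\mathcal L}\end{bmatrix}\bigl(I_d+\lambda P_{\mathcal L}(\widetilde A-\lambda)^{-1}|_{\mathcal L}\bigr)^{-1}\qquad(\lambda\in\mathbb C\setminus\mathbb R),$$ where $\widetilde A$ ranges over the set of all selfadjoint extensions of $\widehat A$ with exit into a Hilbert space $\widetilde{\mathcal H}\oplus\mathcal L\supset\mathcal H\oplus\mathcal L$. Moreover, setting $\psi(\lambda)=P_{\mathcal L}(\widetilde A-\lambda)^{-1}|_{\mathcal L}$ and $\varphi(\lambda)=I_d+\lambda\psi(\lambda)$, the corresponding linear mapping $F:\mathcal X\to\mathcal H(\varphi,\psi)$ is given by $$(Fh)(\lambda)=P_{\mathcal L}(\widetilde A-\lambda)^{-1}\widehat h,\qquad h\in\mathcal X.$$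
   Context: Data set: $\mathcal X$ is a complex linear space, $B_1,B_2$ are linear operators in $\mathcal X$, $C_1,C_2$ are linear operators from $\mathcal X$ to $\mathbb C^d$, and $K$ is a nonnegative sesquilinear form on $\mathcal X$ (linear in the first argument). $N^{d\times d}$ is the class of holomorphic $d\times d$ matrix functions $m$ on $\mathbb C\setminus\mathbb R$ with $m(\bar\lambda)=m(\lambda)^*$ for which the kernel $\mathsf N^m_\omega(\lambda)=\frac{m(\lambda)-m(\omega)^*}{\lambda-\bar\omega}$ is nonnegative on $\mathbb C_+$ (equivalently on $\mathbb C_+\cup\mathbb C_-$). $\mathcal H(m)$ is the reproducing kernel Hilbert space of $\mathbb C^d$-valued functions on $\mathbb C\setminus\mathbb R$ with this kernel: $\mathsf N^m_\omega(\cdot)u\in\mathcal H(m)$ and $\langle f,\mathsf N^m_\omega(\cdot)u\rangle_{\mathcal H(m)}=u^*f(\omega)$. Problem $AIP(B_1,B_2,C_1,C_2,K)$ in $N^{d\times d}$: find $m\in N^{d\times d}$ such that for some linear mapping $F:\mathcal X\to\mathcal H(m)$ and all $h\in\mathcal X$: (C1) $(FB_2h)(\lambda)-\lambda(FB_1h)(\lambda)=\begin{bmatrix} I&-m(\lambda)\end{bmatrix}\begin{bmatrix} C_1h\\ C_2h\end{bmatrix}$; (C2) $\|Fh\|^2_{\mathcal H(m)}\le K(h,h)$. $\mathcal H$ is the completion of $\mathcal X/\ker K$, where $\ker K=\{h:K(h,h)=0\}$, with the inner product $(\widehat h,\widehat g)_{\mathcal H}=K(h,g)$, $\widehat h=h+\ker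 K$. In $\mathcal H\oplus\mathcal L$ consider the linear relation $$\widehat A=\left\{\left\{\begin{bmatrix}\widehat{B_1h}\\ C_1h\end{bmatrix},\begin{bmatrix}\widehat{B_2h}\\ C_2h\end{bmatrix}\right\}:h\in\mathcal X\right\},$$ which is symmetric. A selfadjoint extension of $\widehat A$ with exit is a selfadjoint linear relation $\widetilde A\supset\widehat A$ in $\widetilde{\mathcal H}\oplus\mathcal L$, where $\widetilde{\mathcal H}$ is a Hilbert space containing $\mathcal H$ as a closed subspace. $P_{\mathcal L}$ is the orthogonal projection onto $\mathcal L$, and $\widehat h\in\mathcal H$ is identified with $\begin{bmatrix}\widehat h\\0\end{bmatrix}$. For the pair $\{\varphi,\psi\}$ of the claim, which satisfies $\varphi(\lambda)-\lambda\psi(\lambda)=I$, $\mathcal H(\varphi,\psi)$ is the reproducing kernel Hilbert space of $\mathbb C^d$-valued functions on $\mathbb C\setminus\mathbb R$ with the kernel $\frac{\psi(\bar\lambda)^*\varphi(\bar\omega)-\varphi(\bar\lambda)^*\psi(\bar\omega)}{\lambda-\bar\omega}$ (extended by continuity to $\lambda=\bar\omega$). The ''corresponding linear mapping $F:\mathcal X\to\mathcal H(\varphi,\psi)$'' is the mapping satisfying the conditions for this pair: $(FB_2h)(\lambda)-\lambda(FB_1h)(\lambda)=\varphi(\lambda)C_1h-\psi(\lambda)C_2h$ and $\|Fh\|^2_{\mathcal H(\varphi,\psi)}\le K(h,h)$ for all $h\in\mathcal X$. *)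

(* Defs.v *)
From HB Require Import structures.
From mathcomp Require Import all_boot all_order all_algebra complex.
From mathcomp Require Import all_classical all_reals all_analysis.

Set Implicit Arguments.
Unset Strict Implicit.
Unset Printing Implicit Defensive.

Import Order.TTheory GRing.Theory Num.Theory Num.Def.
Import numFieldNormedType.Exports.

Local Open Scope classical_set_scope.
Local Open Scope ring_scope.
Local Open Scope sesquilinear_scope.

(* Inner products and sesquilinear forms are linear in the first argument and
   conjugate linear in the second one. *)
Record hilbert (R : realType) := Hilbert {
  hs_sort :> lmodType R[i];
  hdot : {dot hs_sort for conjC};
  hs_complete : forall u : nat -> hs_sort,
    (forall e : R[i], 0 < e -> exists N, forall m n, (N <= m)%N -> (N <= n)%N ->
       hdot (u m - u n) (u m - u n) < e) ->
    exists l, forall e : R[i], 0 < e -> exists N, forall n, (N <= n)%N ->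
       hdot (u n - l) (u n - l) < e }.

Definition cdot (R : realType) d (u v : 'cV[R[i]]_d) : R[i] :=
  (v^t* *m u) 0 0.

Record aip_data (R : realType) (d : nat) := AipData {
  aX : lmodType R[i];
  aB1 : {linear aX -> aX};
  aB2 : {linear aX -> aX};
  aC1 : {linear aX -> 'cV[R[i]]_d};
  aC2 : {linear aX -> 'cV[R[i]]_d};
  aK : {bilinear aX -> aX -> R[i] | *%R & (conjC \; *%R)};
  aK_ge0 : forall h, 0 <= aK h h }.

Definition nonreal (R : realType) (z : R[i]) : Prop := complex.Im z != 0.

(* Functions on C \ R are represented by total functions on C of which only the
   values at nonreal points are ever used. *)

Section Kernels.
Variables (R : realType) (d : nat).
Implicit Types (m phi psi : R[i] -> 'M[R[i]]_d) (k : R[i] -> R[i] -> 'M[R[i]]_d).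

(* A kernel takes the base point (the lower index) as first argument. *)
Definition nev_kernel m (w l : R[i]) : 'M[R[i]]_d :=
  (l - w^*)^-1 *: (m l - (m w)^t*).

Definition pair_kernel phi psi (w l : R[i]) : 'M[R[i]]_d :=
  (l - w^*)^-1 *: ((psi l^*)^t* *m phi w^* - (phi l^*)^t* *m psi w^*).

(* Extension by continuity to the points l = w^*, where the quotients above are
   not meaningful. *)
Definition kernel_ext k (w l : R[i]) : 'M[R[i]]_d :=
  if l == w^* then
    \matrix_(i, j) lim ((k w z i j : R[i]^o) @[z --> (l : R[i]^o)^'])
  else k w l.

Definition kernel_nonneg (D : set R[i]) k : Prop :=
  forall (n : nat) (w : 'I_n -> R[i]) (u : 'I_n -> 'cV[R[i]]_d),
    (forall i, D (w i)) ->
    0 <= \sum_(i < n) \sum_(j < n) cdot (k (w i) (w j) *m u i) (u j).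

Definition holomorphic_nonreal m : Prop :=
  forall z, nonreal z -> forall i j,
    derivable (fun t : R[i]^o => (m t i j : R[i]^o)) (z : R[i]^o) 1.

Definition nevanlinna m : Prop :=
  [/\ holomorphic_nonreal m,
      forall l, nonreal l -> m l^* = (m l)^t* &
      kernel_nonneg [set l | 0 < complex.Im l] (nev_kernel m)].

(* A Hilbert space of C^d-valued functions on C \ R: a vector f is identified
   with the function rk_eval f. *)
Record rkhs k := Rkhs {
  rk_space :> hilbert R;
  rk_eval : rk_space -> R[i] -> 'cV[R[i]]_d;
  rk_eval_linear : forall (a : R[i]) f g l, nonreal l ->
    rk_eval (a *: f + g) l = a *: rk_eval f l + rk_eval g l;
  rk_eval_inj : forall f g,
    (forall l, nonreal l -> rk_eval f l = rk_eval g l) -> f = g;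
  rk_reproducing : forall w u, nonreal w ->
    exists2 ku : rk_space,
      forall l, nonreal l -> rk_eval ku l = kernel_ext k w l *m u &
      forall f, hdot rk_space f ku = cdot (rk_eval f w) u }.

End Kernels.

Section Relations.
Variables (R : realType) (V : lmodType R[i]) (ip : V -> V -> R[i]).

(* A linear relation is represented by its graph. *)
Definition adjoint_rel (A : set (V * V)) : set (V * V) :=
  [set f | forall g, A g -> ip f.2 g.1 = ip f.1 g.2].

(* No linearity clause is needed: an adjoint is always a linear subspace. *)
Definition selfadjoint_rel (A : set (V * V)) : Prop := A = adjoint_rel A.

(* (A - l)^-1 = {(g - l f, f) : (f, g) in A}; for selfadjoint A (in a Hilbert
   space) and nonreal l this is the graph of an everywhere defined operator, so
   that the default value 0 is not used. *)
Definition resolvent (A : set (V * V)) (l : R[i]) (y : V) : V :=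
  xget 0 [set x | A (x, y + l *: x)].

End Relations.

Section Extensions.
Variables (R : realType) (d : nat).

Definition sum_dot (H : hilbert R) (x y : H * 'cV[R[i]]_d) : R[i] :=
  hdot H x.1 y.1 + cdot x.2 y.2.

Record exit_extension (H : hilbert R)
    (A : set ((H * 'cV[R[i]]_d) * (H * 'cV[R[i]]_d))) := ExitExtension {
  ex_space : hilbert R;
  ex_emb : {linear H -> ex_space};
  ex_isometry : forall x y, hdot ex_space (ex_emb x) (ex_emb y) = hdot H x y;
  ex_rel : set ((ex_space * 'cV[R[i]]_d) * (ex_space * 'cV[R[i]]_d));
  ex_selfadjoint : selfadjoint_rel (@sum_dot ex_space) ex_rel;
  ex_extends : forall f, A f ->
    ex_rel ((ex_emb f.1.1, f.1.2), (ex_emb f.2.1, f.2.2)) }.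

Arguments ex_rel {H A} e _ : rename.

Section Resolvent.
Variables (H : hilbert R) (A : set ((H * 'cV[R[i]]_d) * (H * 'cV[R[i]]_d))).
Variable T : exit_extension A.

(* The matrix, in the standard basis, of P_L (T - l)^-1 restricted to L. *)
Definition psi_of (l : R[i]) : 'M[R[i]]_d :=
  \matrix_(i, j) (resolvent (ex_rel T) l (0, delta_mx j 0)).2 i 0.

Definition phi_of (l : R[i]) : 'M[R[i]]_d := 1%:M + l *: psi_of l.

(* P_L (T - l)^-1 x for x in H *)
Definition F_of (x : H) (l : R[i]) : 'cV[R[i]]_d :=
  (resolvent (ex_rel T) l (ex_emb T x, 0)).2.

End Resolvent.
End Extensions.

Section AIP.
Variables (R : realType) (d : nat) (D : aip_data R d).

Definition aip_identity : Prop := forall h g,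
  aK D (aB2 D h) (aB1 D g) - aK D (aB1 D h) (aB2 D g)
  = cdot (aC1 D h) (aC2 D g) - cdot (aC2 D h) (aC1 D g).

Definition aip_solution (m : R[i] -> 'M[R[i]]_d) : Prop :=
  nevanlinna m /\
  exists (H : rkhs (nev_kernel m)) (F : {linear aX D -> H}),
    (forall h l, nonreal l ->
       rk_eval (F (aB2 D h)) l - l *: rk_eval (F (aB1 D h)) l
       = row_mx 1%:M (- m l) *m col_mx (aC1 D h) (aC2 D h)) /\
    (forall h, hdot H (F h) (F h) <= aK D h h).

Definition pair_map (phi psi : R[i] -> 'M[R[i]]_d)
    (H : rkhs (pair_kernel phi psi)) (F : {linear aX D -> H}) : Prop :=
  (forall h l, nonreal l ->
     rk_eval (F (aB2 D h)) l - l *: rk_eval (F (aB1 D h)) l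
     = phi l *m aC1 D h - psi l *m aC2 D h) /\
  (forall h, hdot H (F h) (F h) <= aK D h h).

(* The completion of X / ker K, characterized by the map h |-> h + ker K, which
   is isometric and has dense range; it is unique up to a unitary operator. *)
Record completion := Completion {
  cp_space :> hilbert R;
  cp_hat : {linear aX D -> cp_space};
  cp_isometry : forall h g, hdot cp_space (cp_hat h) (cp_hat g) = aK D h g;
  cp_dense : forall (x : cp_space) (e : R[i]), 0 < e ->
    exists h, hdot cp_space (x - cp_hat h) (x - cp_hat h) < e }.

Definition hat_rel (H : completion) :
    set ((H * 'cV[R[i]]_d) * (H * 'cV[R[i]]_d)) :=
  [set f | exists h, f = ((cp_hat H (aB1 D h), aC1 D h),
                          (cp_hat H (aB2 D h), aC2 D h))].

End AIP.

Arguments hat_rel {R d D} H _ : rename.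

(* Main.v *)
Require Import Defs.
From HB Require Import structures.
From mathcomp Require Import all_boot all_order all_algebra complex.
From mathcomp Require Import all_classical all_reals all_analysis.
From mathcomp Require Import ring lra.

Set Implicit Arguments.
Unset Strict Implicit.
Unset Printing Implicit Defensive.

Import Order.TTheory GRing.Theory Num.Theory Num.Def.
Import numFieldNormedType.Exports.

Local Open Scope classical_set_scope.
Local Open Scope ring_scope.
Local Open Scope sesquilinear_scope.

(** For a selfadjoint relation [T] in [Hs (+) L], put [psi(l) v = P_L (T - l)^-1 v]
    and [g(l) v = P_Hs (T - l)^-1 v].  The symmetry of [T] says that
    [(l - w^* ) <g(l) u, g(w) v> = <psi(l) u, phi(w) v> - <phi(l) u, psi(w) v>],
    so that the kernel of the pair [{phi, psi}] is the Gram kernel of the family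
    [g], its space is the closed span of this family, and [F] is the orthogonal
    projection onto that span.  The same holds for [m = psi phi^-1] and the
    family [g phi^-1]; [phi(l)] is injective because [phi(l) u = 0] forces
    [{(0, y), (0, 0)}] to be in [T] with [y = psi(l) u], and then [y] is
    orthogonal to [ran C2].

    Conversely, let [F] map into a reproducing kernel space [S] of a pair
    [{phi, psi}].  The relation
    [{{(f, u), (f', v)} : f'(l) - l f(l) = phi(l) u - psi(l) v}] is selfadjoint
    in [S (+) L]: it is the adjoint of the symmetric relation spanned by the
    kernel functions, and it has no nonreal eigenvalue.  It contains all the
    pairs [{(F B1 h, C1 h), (F B2 h, C2 h)}], hence [{B1 h, B2 h}] is symmetric
    for the defect form [K - <F, F>].  Any selfadjoint extension with exit of
    this second relation, added orthogonally to the first one, extends the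
    relation of the data, since [h |-> (F h, h)] is isometric for [K]. *)

(** * Hilbert spaces *)

(** An element of a reproducing kernel space comes with no continuity: only the reproducing property
    is given, and on the diagonal the kernel is a limit. An eigenfunction f of the model relation at
    l satisfies (z - l) f(z) = 0, which kills f only off l. The value at l is reached by showing
    that the kernel functions are continuous along l + 1/(n+1); this shift is real, so Im l, on
    which the estimates depend, stays fixed.

    A solution m enters the model as the pair {1, m}, which is not normalized by phi - l psi = 1.
    The model asks only that phi - l psi be injective; the extension then has psi = m (1 - l m)^-1
    and phi = (1 - l m)^-1, and m comes back as psi phi^-1.

    The two conditions on F need not determine F. The exit part built on the defect form depends on
    F, so a given F is represented by an extension of its own, which shares only psi with the one
    that defined the pair.

    Limits are carried as explicit bounds c/(n+1), which turns completeness and closedness into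
    inequalities. *)

Section ComplexModulus.
Variable R : realType.
Local Notation C := R[i].
Implicit Types z w : C.

(** The norm of [R[i]] takes its values in [R[i]], whose order is partial; a modulus in [R] can be
    handled by [lra] and [nra]. *)
Definition cabs z : R := Normc.normc z.

Lemma normcabs z : `|z| = (cabs z)%:C%C.
Proof. by rewrite normc_def; case: z. Qed.

Lemma cabs_ge0 z : 0 <= cabs z.
Proof. by case: z => a b; exact: sqrtr_ge0. Qed.

Lemma cabs0 : cabs 0 = 0.
Proof. exact: Normc.normc0. Qed.

Lemma cabs_eq0 z : cabs z = 0 -> z = 0.
Proof. exact: Normc.eq0_normc. Qed.

Lemma cabsM z w : cabs (z * w) = cabs z * cabs w.
Proof. exact: Normc.normcM. Qed.

Lemma cabsD z w : cabs (z + w) <= cabs z + cabs w.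
Proof. exact: le_normcD. Qed.

Lemma cabsN z : cabs (- z) = cabs z.
Proof. exact: normcN. Qed.

Lemma cabsC z : cabs z^* = cabs z.
Proof. by case: z => a b; rewrite /cabs /= sqrrN. Qed.

Lemma cabs_sqr z : cabs z ^+ 2 = complex.Re z ^+ 2 + complex.Im z ^+ 2.
Proof. by case: z => a b; rewrite /cabs /= sqr_sqrtr// addr_ge0 ?sqr_ge0. Qed.

Lemma Re_cabs z : `|complex.Re z| <= cabs z.
Proof.
rewrite -(@ler_pXn2r _ 2) ?nnegrE ?cabs_ge0//.
by rewrite cabs_sqr real_normK ?num_real// lerDl sqr_ge0.
Qed.

Lemma Im_cabs z : `|complex.Im z| <= cabs z.
Proof.
rewrite -(@ler_pXn2r _ 2) ?nnegrE ?cabs_ge0//.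
by rewrite cabs_sqr real_normK ?num_real// lerDr sqr_ge0.
Qed.

Lemma cabs_ReIm z : cabs z <= `|complex.Re z| + `|complex.Im z|.
Proof.
rewrite -(@ler_pXn2r _ 2) ?nnegrE ?cabs_ge0// ?addr_ge0//.
rewrite cabs_sqr -(real_normK (num_real (complex.Re z))) -(real_normK (num_real (complex.Im z))).
have := normr_ge0 (complex.Re z); have := normr_ge0 (complex.Im z); nra.
Qed.

Lemma cabs_real (r : R) : cabs r%:C%C = `|r|.
Proof. by rewrite /cabs /= expr0n addr0 sqrtr_sqr. Qed.

Lemma cabs_realB (r s : R) : cabs (r%:C%C - s%:C%C) = `|r - s|.
Proof. by rewrite -cabs_real rmorphB. Qed.

Lemma cabsB z w : cabs (z - w) = cabs (w - z).
Proof. by rewrite -cabsN opprB. Qed.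

Lemma mulCC z : z * z^* = (cabs z ^+ 2)%:C%C.
Proof.
case: z => a b; rewrite cabs_sqr; apply/eqP; rewrite eq_complex /=.
by apply/andP; split; apply/eqP; ring.
Qed.

Lemma conjRc (r : R) : (r%:C%C)^* = r%:C%C.
Proof. by apply/eqP; rewrite eq_complex /= oppr0 !eqxx. Qed.

Lemma ge0_Re z : 0 <= z -> z = (complex.Re z)%:C%C /\ 0 <= complex.Re z.
Proof. by case: z => a b; rewrite lecE /= => /andP[/eqP -> ->]. Qed.

Lemma Im_conj z : complex.Im z^* = - complex.Im z.
Proof. by case: z. Qed.

Lemma Re_realM (r : R) z : complex.Re (r%:C%C * z) = r * complex.Re z.
Proof. by case: z => a b /=; ring. Qed.

Lemma ImM_real (r : R) z : complex.Im (z * r%:C%C) = complex.Im z * r.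
Proof. by case: z => a b /=; ring. Qed.

(* The rate of all the Cauchy sequences below. *)
Definition harm n : R := n.+1%:R^-1.

Lemma harm_gt0 n : 0 < harm n.
Proof. by rewrite invr_gt0 ltr0n. Qed.

Lemma harm_ge0 n : 0 <= harm n.
Proof. exact/ltW/harm_gt0. Qed.

Lemma harm_lt (e : R) : 0 < e -> exists n, harm n < e.
Proof.
move=> e0; have [n ne] : exists n : nat, e^-1 < n%:R.
  exists (Num.bound e^-1); apply: archi_boundP; rewrite invr_ge0; exact: ltW.
exists n; rewrite /harm -[ltRHS]invrK ltf_pV2 ?posrE ?invr_gt0 ?ltr0n//.
by apply: lt_trans ne _; rewrite ltr_nat.
Qed.

(** The usual end of a limit argument: [c] is arbitrary and absorbs whatever constants the estimate
    has produced. *)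
Lemma le_harm (a b c : R) : (forall n, a <= b + c * harm n) -> a <= b.
Proof.
move=> H; rewrite leNgt; apply/negP => ba.
have c0 : 0 < c.
  rewrite ltNge; apply/negP => c0; have := H 0%N; rewrite leNgt => /negP; apply.
  by have := harm_gt0 0%N; nra.
have ab : 0 < a - b by rewrite subr_gt0.
have [n nc] := harm_lt (divr_gt0 ab c0).
have := H n; rewrite leNgt => /negP; apply.
by move: nc; rewrite ltr_pdivlMr// mulrC ltrBrDl.
Qed.

(** Otherwise h < x, so b h^2 <= b h x and x^2 <= (a + b) h x, which is too small. It turns a
    quadratic estimate into a linear rate in h. *)
Lemma quadratic_le (a b h x : R) : 0 <= a -> 0 <= b -> 0 < h -> 0 <= x ->
  x ^+ 2 <= a * h * x + b * h ^+ 2 -> x <= (a + b + 1) * h.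
Proof.
move=> a0 b0 h0 x0 hx; rewrite leNgt; apply/negP => lt_x.
have h1 : (a + b + 1) * h * x <= x ^+ 2 by rewrite expr2 ler_wpM2r// ltW.
have ab : 0 <= (a + b) * h by rewrite mulr_ge0 ?addr_ge0 ?(ltW h0).
have h2 : b * h ^+ 2 <= b * h * x.
  by rewrite expr2 mulrA ler_wpM2l ?mulr_ge0 ?(ltW h0)//; lra.
have : h * x <= 0 by lra.
by rewrite pmulr_rle0//; lra.
Qed.

(** The limit is the supremum of the lower bounds [u n - c * harm n]; every [u m + c * harm m] lies
    above all of them, so the rate keeps its constant. *)
Lemma real_complete (u : nat -> R) (c : R) :
  (forall m n, `|u m - u n| <= c * (harm m + harm n)) ->
  exists l, forall n, `|u n - l| <= c * harm n.
Proof.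
move=> Hu; pose E := [set u n - c * harm n | n in setT].
have ubE m : ubound E (u m + c * harm m).
  by move=> _ [n _ <-]; have := Hu m n; rewrite ler_norml => /andP[]; lra.
have E0 : E !=set0 by exists (u 0%N - c * harm 0); exists 0%N.
exists (sup E) => n.
have h1 : u n - c * harm n <= sup E.
  by apply: ub_le_sup; [exists (u 0%N + c * harm 0); exact: ubE | exists n].
have h2 : sup E <= u n + c * harm n by apply: ge_sup => //; exact: ubE.
by rewrite ler_norml; apply/andP; split; lra.
Qed.

Lemma complex_complete (u : nat -> C) (c : R) :
  (forall m n, cabs (u m - u n) <= c * (harm m + harm n)) ->
  exists l, forall n, cabs (u n - l) <= c * harm n.
Proof.
move=> Hu.
have [a Ha] : exists l, forall n, `|complex.Re (u n) - l| <= c * harm n.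
  apply: real_complete => m n; apply: le_trans (Hu m n).
  by apply: le_trans (Re_cabs _); case: (u m) => ? ?; case: (u n).
have [b Hb] : exists l, forall n, `|complex.Im (u n) - l| <= c * harm n.
  apply: real_complete => m n; apply: le_trans (Hu m n).
  by apply: le_trans (Im_cabs _); case: (u m) => ? ?; case: (u n).
(* The two coordinates alone would give the constant 2c; a detour through [u m] with m large
   restores c. *)
exists (a +i* b)%C => n; apply: (@le_harm _ _ (3 * c)) => m.
rewrite -(subrKA (u m)); apply: le_trans (cabsD _ _) _.
have : cabs (u m - (a +i* b)%C) <= c * harm m + c * harm m.
  apply: le_trans (cabs_ReIm _) _; move: (Ha m) (Hb m).
  by case: (u m) => x y /= h1 h2; apply: lerD.
by have := Hu n m; lra.
Qed.

Lemma cabs_eq0_harm z (c : R) : (forall n, cabs z <= c * harm n) -> z = 0.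
Proof.
move=> H; apply: cabs_eq0; apply/le_anti; rewrite cabs_ge0 andbT.
by apply: (@le_harm _ _ c) => n; rewrite add0r.
Qed.

End ComplexModulus.

Section NonnegativeForms.

(** * Nonnegative sesquilinear forms and their seminorms *)

Variables (R : realType) (V : lmodType R[i]).
Local Notation C := R[i].
Variable K : {bilinear V -> V -> C | *%R & (conjC \; *%R)}.
Hypothesis K_ge0 : forall x, 0 <= K x x.

Definition nrm (f : V -> V -> C) (x : V) : R := Num.sqrt (complex.Re (f x x)).

(* Polarization: [K] is not assumed hermitian, but its diagonal is real. *)
Lemma psd_herm x y : K x y = (K y x)^*.
Proof.
have im a b : complex.Im (K a b + K b a) = 0.
  have := K_ge0 (a + b); rewrite linearDl 2!linearDr => /ger0_Im.
  have /ger0_Im := K_ge0 a; have /ger0_Im := K_ge0 b.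
  case: (K a a) => ? ?; case: (K b b) => ? ?; case: (K a b) => ? ?; case: (K b a) => ? ? /=.
  lra.
have := im x y; have := im ('i *: x) y.
rewrite linearZl_LR linearZr_LR /= -complexiE.
case: (K x y) => a b; case: (K y x) => a' b' /=.
move=> h1 h2; apply/eqP; rewrite eq_complex /=; apply/andP; split; apply/eqP; lra.
Qed.

Lemma nrm_ge0 x : 0 <= nrm K x.
Proof. exact: sqrtr_ge0. Qed.

Lemma nrmE x : K x x = (nrm K x ^+ 2)%:C%C.
Proof. by have [e h] := ge0_Re (K_ge0 x); rewrite {1}e sqr_sqrtr. Qed.

Lemma nrm_sqr x : nrm K x ^+ 2 = complex.Re (K x x).
Proof. by rewrite nrmE. Qed.

Lemma nrmB2 x y : nrm K (x - y) ^+ 2 =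
  nrm K x ^+ 2 + nrm K y ^+ 2 - 2 * complex.Re (K x y).
Proof.
rewrite !nrm_sqr linearBl 2!linearBr [K y x]psd_herm.
by case: (K x x) (K y y) (K x y) => [? ?] [? ?] [? ?] /=; ring.
Qed.

Lemma nrmD2 x y : nrm K (x + y) ^+ 2 =
  nrm K x ^+ 2 + nrm K y ^+ 2 + 2 * complex.Re (K x y).
Proof.
rewrite !nrm_sqr linearDl 2!linearDr [K y x]psd_herm.
by case: (K x x) (K y y) (K x y) => [? ?] [? ?] [? ?] /=; ring.
Qed.

Lemma nrmZ a x : nrm K (a *: x) = cabs a * nrm K x.
Proof.
apply/eqP; rewrite -(@eqrXn2 _ 2) ?mulr_ge0 ?nrm_ge0 ?cabs_ge0//.
rewrite nrm_sqr linearZl_LR linearZr_LR /= nrmE mulrA mulCC exprMn.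
by apply/eqP; rewrite /=; ring.
Qed.

Lemma nrm0 : nrm K 0 = 0.
Proof. by rewrite -(scale0r 0) nrmZ cabs0 mul0r. Qed.

Lemma nrmN x : nrm K (- x) = nrm K x.
Proof. by rewrite -scaleN1r nrmZ cabsN /cabs Normc.normc1 mul1r. Qed.

Lemma nrmB x y : nrm K (x - y) = nrm K (y - x).
Proof. by rewrite -nrmN opprB. Qed.

Lemma CauchySchwarz_psd x y : cabs (K x y) <= nrm K x * nrm K y.
Proof.
rewrite -(@ler_pXn2r _ 2) ?nnegrE ?mulr_ge0 ?nrm_ge0 ?cabs_ge0// exprMn.
set a := nrm K x ^+ 2; set b := nrm K y ^+ 2; set c := cabs (K x y) ^+ 2.
have b0 : 0 <= b by exact: sqr_ge0.
have c0 : 0 <= c by exact: sqr_ge0.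
(* Nonnegativity at x - t K(x, y) y: the factor K(x, y) makes the cross term real. *)
have H (t : R) : 0 <= a + t ^+ 2 * c * b - 2 * t * c.
  have := sqr_ge0 (nrm K (x - (t%:C%C * K x y) *: y)).
  rewrite nrmB2 nrmZ cabsM cabs_real linearZr_LR /= rmorphM /= conjRc.
  rewrite -(mulrA t%:C%C) [conjC _ * _]mulrC mulCC Re_realM /= -/c -/a !exprMn.
  rewrite real_normK ?num_real// -/b -/c.
  by lra.
have [b_eq0|bN0] := eqVneq b 0.
  rewrite b_eq0 mulr0 leNgt; apply/negP => cgt0.
  (* The bound is now linear in t with slope -2c, and this t gives it the value -a - 2. *)
  have := H ((a + 1) / c); rewrite b_eq0 mulr0 addr0.
  rewrite -mulrA divfK ?gt_eqF// leNgt => /negP; apply.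
  by have := sqr_ge0 (nrm K x); rewrite -/a; lra.
have := H b^-1.
have -> : b^-1 ^+ 2 * c * b = b^-1 * c by field.
have b1 : 0 < b by rewrite lt_neqAle eq_sym bN0.
move=> h; have : 0 <= (a + b^-1 * c - 2 * b^-1 * c) * b by rewrite mulr_ge0.
have -> : (a + b^-1 * c - 2 * b^-1 * c) * b = a * b - c by field.
by rewrite subr_ge0.
Qed.

Lemma nrmD x y : nrm K (x + y) <= nrm K x + nrm K y.
Proof.
rewrite -(@ler_pXn2r _ 2) ?nnegrE ?addr_ge0 ?nrm_ge0// nrmD2.
have := le_trans (ler_norm _) (le_trans (Re_cabs _) (CauchySchwarz_psd x y)).
by rewrite sqrrD; lra.
Qed.

Lemma nrm_tri z x y : nrm K (x - y) <= nrm K (x - z) + nrm K (z - y).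
Proof. by rewrite -(subrKA z) nrmD. Qed.

End NonnegativeForms.

(** * Hilbert norm, completeness with a rate, orthogonal projection *)

Section HilbertNorm.
Variables (R : realType).
Local Notation C := R[i].

Lemma harm_le m n : (m <= n)%N -> harm R n <= harm R m.
Proof. by move=> mn; rewrite /harm lef_pV2 ?posrE ?ltr0n// ler_nat. Qed.

Lemma lt_sqr_Re (f : C) (r : R) (e : C) : 0 < e -> 0 <= r -> f = (r ^+ 2)%:C%C ->
  (f < e) = (r < Num.sqrt (complex.Re e)).
Proof.
move=> e0 r0 ->; have [ee er] := ge0_Re (ltW e0).
rewrite {1}ee ltcR -[X in _ < X]sqr_sqrtr//.
by rewrite ltr_pXn2r// ?nnegrE ?sqrtr_ge0.
Qed.

Lemma sqrt_Re_gt0 (e : C) : 0 < e -> 0 < Num.sqrt (complex.Re e).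
Proof. by rewrite ltcE sqrtr_gt0 => /andP[]. Qed.

Section Space.
Variable H : hilbert R.
Implicit Types x y z : H.

Definition hnrm x : R := nrm (hdot H) x.

Lemma hdot_ge0 x : 0 <= hdot H x x.
Proof. exact: dnorm_ge0. Qed.

Lemma hdotC x y : hdot H x y = (hdot H y x)^*.
Proof. exact: psd_herm hdot_ge0 _ _. Qed.

Lemma hdotDl x y z : hdot H (x + y) z = hdot H x z + hdot H y z.
Proof. exact: linearDl. Qed.

Lemma hdotBl x y z : hdot H (x - y) z = hdot H x z - hdot H y z.
Proof. exact: linearBl. Qed.

Lemma hdotZl a x z : hdot H (a *: x) z = a * hdot H x z.
Proof. exact: linearZl_LR. Qed.

Lemma hdotDr x y z : hdot H z (x + y) = hdot H z x + hdot H z y.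
Proof. exact: linearDr. Qed.

Lemma hdotBr x y z : hdot H z (x - y) = hdot H z x - hdot H z y.
Proof. exact: linearBr. Qed.

Lemma hdotZr a x z : hdot H z (a *: x) = a^* * hdot H z x.
Proof. exact: linearZr_LR. Qed.

Lemma hdotNl x z : hdot H (- x) z = - hdot H x z.
Proof. exact: linearNl. Qed.

Lemma hdotNr x z : hdot H z (- x) = - hdot H z x.
Proof. exact: linearNr. Qed.

Lemma hdot0l z : hdot H 0 z = 0.
Proof. exact: linear0l. Qed.

Lemma hdot0r z : hdot H z 0 = 0.
Proof. exact: linear0r. Qed.

Lemma hnrmE x : hdot H x x = (hnrm x ^+ 2)%:C%C.
Proof. exact: nrmE hdot_ge0 _. Qed.

Lemma hnrm_ge0 x : 0 <= hnrm x.
Proof. exact: nrm_ge0. Qed.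

Lemma hnrm_eq0 x : hnrm x = 0 -> x = 0.
Proof.
by move=> x0; apply/eqP; rewrite -(dnorm_eq0 (hdot H)) hnrmE x0 expr0n.
Qed.

Lemma hnrm0 : hnrm 0 = 0.
Proof. exact: nrm0 hdot_ge0. Qed.

Lemma hnrmB x y : hnrm (x - y) = hnrm (y - x).
Proof. exact: nrmB hdot_ge0 _ _. Qed.

Lemma hnrmZ a x : hnrm (a *: x) = cabs a * hnrm x.
Proof. exact: nrmZ hdot_ge0 _ _. Qed.

Lemma hnrmD x y : hnrm (x + y) <= hnrm x + hnrm y.
Proof. exact: nrmD hdot_ge0 _ _. Qed.

Lemma hnrm_tri z x y : hnrm (x - y) <= hnrm (x - z) + hnrm (z - y).
Proof. exact: nrm_tri hdot_ge0 _ _ _. Qed.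

Lemma hnrmB2 x y : hnrm (x - y) ^+ 2 =
  hnrm x ^+ 2 + hnrm y ^+ 2 - 2 * complex.Re (hdot H x y).
Proof. exact: nrmB2 hdot_ge0 _ _. Qed.

Lemma hnrmD2 x y : hnrm (x + y) ^+ 2 =
  hnrm x ^+ 2 + hnrm y ^+ 2 + 2 * complex.Re (hdot H x y).
Proof. exact: nrmD2 hdot_ge0 _ _. Qed.

Lemma CauchySchwarz_hdot x y : cabs (hdot H x y) <= hnrm x * hnrm y.
Proof. exact: CauchySchwarz_psd hdot_ge0 _ _. Qed.

Lemma hnrm_lim_eq0 x (c : R) : (forall n, hnrm x <= c * harm R n) -> x = 0.
Proof.
move=> h; apply: hnrm_eq0; apply/le_anti; rewrite hnrm_ge0 andbT.
by apply: (@le_harm _ _ _ c) => n; rewrite add0r.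
Qed.

Lemma hilbert_complete (u : nat -> H) (c : R) :
  (forall m n, hnrm (u m - u n) <= c * (harm R m + harm R n)) ->
  exists l, forall n, hnrm (u n - l) <= c * harm R n.
Proof.
move=> Hu.
have c0 : 0 <= c.
  rewrite leNgt; apply/negP => c0; have := Hu 0%N 0%N.
  by have := hnrm_ge0 (u 0%N - u 0%N); have := harm_gt0 R 0; nra.
have [|l Hl] := @hs_complete _ H u.
  move=> e e0; have d0 := sqrt_Re_gt0 e0; set d := Num.sqrt _ in d0.
  have [|N hN] := @harm_lt R (d / (2 * c + 1)); first by rewrite divr_gt0//; lra.
  exists N => m n mN nN; rewrite (lt_sqr_Re e0 _ (hnrmE _)) ?hnrm_ge0//.
  apply: le_lt_trans (Hu m n) _; rewrite -/d.
  move: hN; rewrite ltr_pdivlMr; last lra.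
  by have := harm_le mN; have := harm_le nN; have := harm_gt0 R N; nra.
exists l => n; apply: (@le_harm _ _ _ (c + 1)) => m.
have [|N hN] := Hl ((harm R m ^+ 2)%:C%C).
  by rewrite ltcE /= eqxx exprn_gt0// harm_gt0.
have := hN (maxn N m) (leq_maxl _ _).
rewrite hnrmE ltcR ltr_pXn2r ?nnegrE ?hnrm_ge0 ?harm_ge0// => h1.
apply: le_trans (hnrm_tri (u (maxn N m)) _ _) _.
have := Hu n (maxn N m); have := harm_le (leq_maxr N m).
by move=> h2 h3; have : c * harm R (maxn N m) <= c * harm R m; [apply: ler_wpM2l | lra].
Qed.

Definition closed_subspace (M : set H) : Prop :=
  [/\ M 0, (forall a x y, M x -> M y -> M (a *: x + y)) &
      forall y, (forall n, exists2 z, M z & hnrm (y - z) <= harm R n) -> M y].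

Lemma projection (M : set H) (f : H) : closed_subspace M ->
  exists2 g, M g & forall z, M z -> hdot H (f - g) z = 0.
Proof.
move=> [M0 Mlin Mcl].
pose E := [set hnrm (f - z) ^+ 2 | z in M].
have lbE : lbound E 0 by move=> _ [z _ <-]; exact: sqr_ge0.
have hasE : has_inf E.
  by split; [exists (hnrm (f - 0) ^+ 2), 0 | exists 0].
pose d := inf E.
have dle z : M z -> d <= hnrm (f - z) ^+ 2.
  by move=> Mz; apply: ge_inf; [exists 0 | exists z].
(* With the tolerance [harm R n ^+ 2 / 2] the parallelogram law bounds the squared distance of [z m]
   and [z n] by the sum of the squares of the two rates. *)
have /choice[z Hz] n : exists z, M z /\ hnrm (f - z) ^+ 2 <= d + harm R n ^+ 2 / 2.
  have : d < d + harm R n ^+ 2 / 2.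
    by rewrite ltrDl divr_gt0// exprn_gt0// harm_gt0.
  by move=> /(inf_lt hasE.1) [_ [z Mz <-] /ltW ?]; exists z.
have Cz m n : hnrm (z m - z n) <= 1 * (harm R m + harm R n).
  rewrite mul1r -(@ler_pXn2r _ 2) ?nnegrE ?addr_ge0 ?hnrm_ge0 ?harm_ge0//.
  have [Mm hm] := Hz m; have [Mn hn] := Hz n.
  have Mmid : M (2^-1 *: z m + 2^-1 *: z n).
    by apply: (Mlin) => //; rewrite -[_ *: z n]addr0; apply: Mlin.
  have := dle _ Mmid.
  have -> : z m - z n = (f - z n) - (f - z m) by rewrite opprB [RHS]addrC subrKA.
  have -> : f - (2^-1 *: z m + 2^-1 *: z n) = 2^-1 *: ((f - z n) + (f - z m)).
    rewrite !scalerDr !scalerN addrACA -scalerDl.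
    have -> : 2^-1 + 2^-1 = 1 :> C by rewrite -[X in X + X]mul1r -splitr.
    by rewrite scale1r opprD [in RHS](addrC (- _)).
  rewrite hnrmZ exprMn (hnrmB2 (f - z n)) (hnrmD2 (f - z n)).
  have -> : cabs (2^-1 : C) ^+ 2 = 4^-1.
    have -> : (2^-1 : C) = (2^-1)%:C%C by rewrite fmorphV rmorph_nat.
    by rewrite cabs_real real_normK ?num_real//; field.
  have := harm_gt0 R m; have := harm_gt0 R n; nra.
have [g Hg] := hilbert_complete Cz.
have Mg : M g.
  apply: Mcl => n; exists (z n); first by have [] := Hz n.
  by rewrite hnrmB -[harm _ _]mul1r.
exists g => // y My.
have dg : hnrm (f - g) ^+ 2 <= d.
  have hle n : hnrm (f - g) ^+ 2 <=
      d + (2 * hnrm (f - z 0%N) + 2 * hnrm (z 0%N - g) + 10) * harm R n.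
    have := hnrm_tri (z n) f g; have := Hg n; have [_] := Hz n.
    have := hnrm_tri g f (z n); rewrite (hnrmB g (z n)).
    have := hnrm_tri (z 0%N) f g.
    have := hnrm_ge0 (f - z n); have := hnrm_ge0 (f - g); have := hnrm_ge0 (z n - g).
    have := harm_gt0 R n; have : harm R n <= 1 by rewrite /harm invf_le1 ?ltr0n// ler1n.
    set a := hnrm (f - g); set b := hnrm (f - z n); set c := hnrm (z n - g); set h := harm R n.
    move=> h1 h0 c0 a0 b0 A1 A2 A3 A4 A5.
    have : a ^+ 2 <= (b + c) ^+ 2 by rewrite ler_pXn2r ?nnegrE ?addr_ge0.
    have : 2 * b * c <= 2 * (a + h) * h by nra.
    have : c ^+ 2 <= h by nra.
    have : h ^+ 2 / 2 <= h by nra.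
    have : a * h <= (hnrm (f - z 0%N) + hnrm (z 0%N - g)) * h by rewrite ler_wpM2r// ltW.
    nra.
  exact: le_harm hle.
have min a : hnrm (f - g) ^+ 2 <= hnrm (f - g - a *: y) ^+ 2.
  apply: le_trans dg _; rewrite -addrA -opprD; apply: dle.
  by rewrite addrC; exact: Mlin.
set w := hdot H (f - g) y.
(* The added 1 covers y = 0 as well; since t (|y|^2 + 1) = 1, the variation equals -t^2 |w|^2 (|y|^2
   + 2). *)
pose t := (hnrm y ^+ 2 + 1)^-1.
have t0 : 0 < t by rewrite invr_gt0 ltr_wpDl// sqr_ge0.
have := min (t%:C%C * w).
rewrite (hnrmB2 (f - g)) hnrmZ cabsM cabs_real linearZr_LR /= -/w rmorphM /= conjRc.
rewrite -(mulrA t%:C%C) [conjC _ * _]mulrC mulCC Re_realM /= => h.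
apply: cabs_eq0; apply/eqP; rewrite -(sqrf_eq0 (cabs w)); apply/eqP/le_anti.
rewrite sqr_ge0 andbT.
move: h; rewrite (gtr0_norm t0) => h.
have {h} : 0 <= t ^+ 2 * cabs w ^+ 2 * hnrm y ^+ 2 - 2 * t * cabs w ^+ 2 by nra.
have -> : t ^+ 2 * cabs w ^+ 2 * hnrm y ^+ 2 - 2 * t * cabs w ^+ 2 =
    - (t ^+ 2 * cabs w ^+ 2 * (hnrm y ^+ 2 + 2)).
  by rewrite /t; field; rewrite gt_eqF// ltr_wpDl// sqr_ge0.
rewrite oppr_ge0 pmulr_lle0; last by rewrite ltr_wpDl// sqr_ge0.
by rewrite pmulr_rle0// exprn_gt0.
Qed.

End Space.
End HilbertNorm.

(** * Construction of Hilbert spaces: direct sums and column vectors *)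

Section HilbertBuilder.
Variables (R : realType) (V : lmodType R[i]) (b : V -> V -> R[i]).
Hypothesis b_linear : forall a x y z, b (a *: x + y) z = a * b x z + b y z.
Hypothesis b_herm : forall x y, b x y = (b y x)^*.
Hypothesis b_pos : forall x, x != 0 -> 0 < b x x.

Let b_bilinear : bilinear_for *%R (conjC \; *%R) b.
Proof.
split=> [z a x y|z a x y] /=; first exact: b_linear.
by rewrite b_herm b_linear rmorphD rmorphM /= -!b_herm.
Qed.

Definition dot_of : {dot V for conjC} :=
  HB.pack b (bilinear_isBilinear.Build R[i] V V R[i] *%R (conjC \; *%R) b b_bilinear)
    (isHermitianSesquilinear.Build R[i] V false conjC b
       (fun x y => etrans (b_herm x y) (esym (mul1r _))))
    (isDotProduct.Build R[i] V b b_pos).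

Lemma dot_of_ge0 x : 0 <= dot_of x x.
Proof. exact: dnorm_ge0. Qed.

Hypothesis b_complete : forall u : nat -> V,
  (forall m n, nrm b (u m - u n) <= harm R m + harm R n) ->
  exists l c, forall n, nrm b (u n - l) <= c * harm R n.

(** A subsequence with steps below [harm R j] satisfies [b_complete], and its limit attracts the
    whole Cauchy sequence. *)
Let b_hs_complete (u : nat -> V) :
    (forall e : R[i], 0 < e -> exists N, forall m n, (N <= m)%N -> (N <= n)%N ->
       dot_of (u m - u n) (u m - u n) < e) ->
    exists l, forall e : R[i], 0 < e -> exists N, forall n, (N <= n)%N ->
       dot_of (u n - l) (u n - l) < e.
Proof.
move=> Hu.
have E := nrmE dot_of_ge0; have P := @nrm_ge0 _ _ dot_of.
have /choice[k Hk] j : exists N, forall m n, (N <= m)%N -> (N <= n)%N ->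
    nrm b (u m - u n) < harm R j.
  have [|N HN] := Hu ((harm R j ^+ 2)%:C%C).
    by rewrite ltcE /= eqxx exprn_gt0// harm_gt0.
  exists N => m n mN nN; have := HN _ _ mN nN.
  by rewrite E ltcR ltr_pXn2r// ?nnegrE ?P ?harm_ge0.
have [i j|l [c Hl]] := @b_complete (u \o k).
  have T := @nrm_tri _ _ dot_of dot_of_ge0 (u (maxn (k i) (k j))) (u (k i)) (u (k j)).
  apply: le_trans T _; apply: lerD; apply: ltW.
    by apply: Hk => //; exact: leq_maxl.
  by apply: Hk => //; exact: leq_maxr.
exists l => e e0; have d0 := sqrt_Re_gt0 e0.
have c0 : 0 <= c.
  rewrite leNgt; apply/negP => c0; have := Hl 0%N.
  by have := P (u (k 0%N) - l); have := harm_gt0 R 0; rewrite /=; nra.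
have [|j hj] := @harm_lt R (Num.sqrt (complex.Re e) / (c + 1)); first by rewrite divr_gt0//; lra.
exists (k j) => n kn; rewrite (lt_sqr_Re e0 _ (E _)) ?P//.
apply: le_lt_trans (@nrm_tri _ _ dot_of dot_of_ge0 (u (k j)) _ _) _.
move: hj; rewrite ltr_pdivlMr ?ltr_wpDl//; apply: le_lt_trans.
by have := Hl j; have := Hk j n (k j) kn (leqnn _); rewrite /=; lra.
Qed.

Definition hilbert_of : hilbert R := Hilbert b_hs_complete.

End HilbertBuilder.

Section DirectSum.
Variables (R : realType) (H1 H2 : hilbert R).
Let b (x y : H1 * H2) : R[i] := hdot H1 x.1 y.1 + hdot H2 x.2 y.2.

Let b_linear a x y z : b (a *: x + y) z = a * b x z + b y z.
Proof. by rewrite /b /= !hdotDl !hdotZl; ring. Qed.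

Let b_herm x y : b x y = (b y x)^*.
Proof. by rewrite /b rmorphD /= -!hdotC. Qed.

Let b_ge0 x : 0 <= b x x.
Proof. by rewrite addr_ge0// hdot_ge0. Qed.

Let b_pos x : x != 0 -> 0 < b x x.
Proof.
move=> x0; rewrite lt_neqAle b_ge0 andbT eq_sym paddr_eq0 ?hdot_ge0//.
by rewrite !dnorm_eq0 -xpair_eqE -surjective_pairing.
Qed.

Let b_sqr x : nrm b x ^+ 2 = hnrm x.1 ^+ 2 + hnrm x.2 ^+ 2.
Proof.
rewrite sqr_sqrtr; last by have [] := ge0_Re (b_ge0 x).
by rewrite /b !hnrmE.
Qed.

Let b_le x : nrm b x <= hnrm x.1 + hnrm x.2.
Proof.
rewrite -(@ler_pXn2r _ 2) ?nnegrE ?addr_ge0 ?hnrm_ge0 ?sqrtr_ge0//.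
by rewrite b_sqr sqrrD; have := hnrm_ge0 x.1; have := hnrm_ge0 x.2; nra.
Qed.

Let b_fst x : hnrm x.1 <= nrm b x.
Proof.
rewrite -(@ler_pXn2r _ 2) ?nnegrE ?hnrm_ge0 ?sqrtr_ge0//.
by rewrite b_sqr lerDl sqr_ge0.
Qed.

Let b_snd x : hnrm x.2 <= nrm b x.
Proof.
rewrite -(@ler_pXn2r _ 2) ?nnegrE ?hnrm_ge0 ?sqrtr_ge0//.
by rewrite b_sqr lerDr sqr_ge0.
Qed.

Let b_complete (u : nat -> H1 * H2) :
  (forall m n, nrm b (u m - u n) <= harm R m + harm R n) ->
  exists l c, forall n, nrm b (u n - l) <= c * harm R n.
Proof.
move=> Hu.
have [m n|l1 h1] := @hilbert_complete _ H1 (fst \o u) 1.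
  by rewrite mul1r; apply: le_trans (Hu m n); exact: (b_fst (u m - u n)).
have [m n|l2 h2] := @hilbert_complete _ H2 (snd \o u) 1.
  by rewrite mul1r; apply: le_trans (Hu m n); exact: (b_snd (u m - u n)).
exists (l1, l2), 2 => n; apply: le_trans (b_le _) _ => /=.
by have := h1 n; have := h2 n; rewrite /=; lra.
Qed.

Definition hsum : hilbert R := hilbert_of b_linear b_herm b_pos b_complete.

Lemma hnrm_fst (x : hsum) : hnrm (x.1 : H1) <= hnrm x.
Proof. exact: b_fst. Qed.

Lemma hnrm_snd (x : hsum) : hnrm (x.2 : H2) <= hnrm x.
Proof. exact: b_snd. Qed.

End DirectSum.

Section ColumnSpace.
Variables (R : realType) (d : nat).
Implicit Types u v : 'cV[R[i]]_d.

Lemma cdotE u v : cdot u v = \sum_i u i 0 * (v i 0)^*.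
Proof. by rewrite /cdot mxE; apply: eq_bigr => i _; rewrite !mxE mulrC. Qed.

Lemma cdot_linear a u v w : cdot (a *: u + v) w = a * cdot u w + cdot v w.
Proof. by rewrite /cdot mulmxDr -scalemxAr !mxE. Qed.

Lemma cdotC u v : cdot u v = (cdot v u)^*.
Proof.
rewrite !cdotE rmorph_sum; apply: eq_bigr => i _ /=.
by rewrite rmorphM /= conjCK mulrC.
Qed.

Let cdot_sqr u : cdot u u = (\sum_i cabs (u i 0) ^+ 2)%:C%C.
Proof. by rewrite cdotE rmorph_sum; apply: eq_bigr => i _ /=; rewrite mulCC. Qed.

Let cdot_ge0 u : 0 <= cdot u u.
Proof. by rewrite cdot_sqr lecE /= eqxx sumr_ge0// => i _; exact: sqr_ge0. Qed.

Let cdot_pos u : u != 0 -> 0 < cdot u u.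
Proof.
move=> u0; rewrite lt_neqAle cdot_ge0 andbT eq_sym; apply: contra_neq u0.
rewrite cdot_sqr => /complexI/psumr_eq0P h; apply/matrixP => i j.
rewrite mxE ord1; apply: cabs_eq0; apply/eqP; rewrite -sqrf_eq0.
by apply/eqP/h => // k _; exact: sqr_ge0.
Qed.

Let nrm_cdot u : nrm (@cdot R d) u ^+ 2 = \sum_i cabs (u i 0) ^+ 2.
Proof.
by rewrite sqr_sqrtr cdot_sqr//= sumr_ge0// => i _; exact: sqr_ge0.
Qed.

Let cabs_le_nrm u i : cabs (u i 0) <= nrm (@cdot R d) u.
Proof.
rewrite -(@ler_pXn2r _ 2) ?nnegrE ?cabs_ge0 ?sqrtr_ge0// nrm_cdot.
by rewrite (bigD1 i)//= lerDl sumr_ge0// => j _; exact: sqr_ge0.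
Qed.

Let cdot_complete (u : nat -> 'cV[R[i]]_d) :
  (forall m n, nrm (@cdot R d) (u m - u n) <= harm R m + harm R n) ->
  exists l c, forall n, nrm (@cdot R d) (u n - l) <= c * harm R n.
Proof.
move=> Hu.
have /choice[l Hl] i : exists l, forall n, cabs (u n i 0 - l) <= 1 * harm R n.
  apply: complex_complete => m n; rewrite mul1r; apply: le_trans (Hu m n).
  by have := cabs_le_nrm (u m - u n) i; rewrite !mxE.
(* The constant d + 1 stands in for the square root of d; only d <= (d + 1)^2 is used. *)
exists (\col_i l i), (d%:R + 1) => n.
rewrite -(@ler_pXn2r _ 2) ?nnegrE ?mulr_ge0 ?addr_ge0 ?harm_ge0 ?sqrtr_ge0//.
rewrite nrm_cdot; apply: (@le_trans _ _ (\sum_(i < d) harm R n ^+ 2)).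
  apply: ler_sum => i _; rewrite ler_pXn2r ?nnegrE ?cabs_ge0 ?harm_ge0//.
  by rewrite !mxE -[harm R n]mul1r.
rewrite sumr_const card_ord -(mulr_natl (harm R n ^+ 2)) exprMn ler_wpM2r ?sqr_ge0// sqrrD.
by have := ler0n R d; nra.
Qed.

Definition hcol : hilbert R := hilbert_of cdot_linear cdotC cdot_pos cdot_complete.

End ColumnSpace.

(** * Closed subspaces as Hilbert spaces *)

Record subspace (R : realType) (V : lmodType R[i]) := Subspace {
  sub_mem : set V;
  sub_mem0 : sub_mem 0;
  sub_mem_linear : forall a x y, sub_mem x -> sub_mem y -> sub_mem (a *: x + y) }.

Section Subspace.
Variables (R : realType) (V : lmodType R[i]) (M : subspace V).

Definition sub_pred : {pred V} := fun x => `[< sub_mem M x >].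

Lemma sub_predP x : reflect (sub_mem M x) (x \in sub_pred).
Proof. exact: asboolP. Qed.

Lemma sub_pred_closed : submod_closed sub_pred.
Proof.
split; first exact/sub_predP/sub_mem0.
by move=> a x y /sub_predP Mx /sub_predP My; apply/sub_predP/sub_mem_linear.
Qed.

HB.instance Definition _ := GRing.isSubmodClosed.Build R[i] V sub_pred sub_pred_closed.

Record sub_space := SubSpace { sub_val : V; _ : sub_val \in sub_pred }.

HB.instance Definition _ := [isSub for sub_val].
HB.instance Definition _ := [Choice of sub_space by <:].
HB.instance Definition _ := [SubChoice_isSubLmodule of sub_space by <:].

Lemma sub_valP (x : sub_space) : sub_mem M (sub_val x).
Proof. by apply/sub_predP; case: x. Qed.

Lemma sub_val_linear a (x y : sub_space) :
  sub_val (a *: x + y) = a *: sub_val x + sub_val y.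
Proof. exact: (linearP (val : sub_space -> V)). Qed.

Definition to_sub x (Mx : sub_mem M x) : sub_space := SubSpace (introT (sub_predP x) Mx).

Lemma sub_val_inj : injective sub_val.
Proof. exact: val_inj. Qed.

End Subspace.

Definition linear_of (K : nzRingType) (U V : lmodType K) (f : U -> V)
  (f_lin : linear f) : {linear U -> V} := HB.pack f (GRing.isLinear.Build K U V *:%R f f_lin).

Section ClosedSubspace.
Variables (R : realType) (H : hilbert R) (M : set H).
Hypothesis M_closed : closed_subspace M.

Definition closed_sub : subspace H :=
  let: And3 M0 Ml _ := M_closed in Subspace M0 Ml.

Lemma closed_subE x : sub_mem closed_sub x = M x.
Proof. by rewrite /closed_sub; case: M_closed. Qed.

Let S := sub_space closed_sub.
Let b (x y : S) : R[i] := hdot H (sub_val x) (sub_val y).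

Let b_linear a x y z : b (a *: x + y) z = a * b x z + b y z.
Proof. by rewrite /b sub_val_linear hdotDl hdotZl. Qed.

Let b_herm x y : b x y = (b y x)^*.
Proof. exact: hdotC. Qed.

Let b_pos x : x != 0 -> 0 < b x x.
Proof.
move=> x0; rewrite dnorm_gt0; apply: contra_neq x0 => x0.
by apply: sub_val_inj; rewrite x0; exact/esym/(raddf0 (val : S -> H)).
Qed.

Let b_complete (u : nat -> S) :
  (forall m n, nrm b (u m - u n) <= harm R m + harm R n) ->
  exists l c, forall n, nrm b (u n - l) <= c * harm R n.
Proof.
move=> Hu.
have B (x y : S) : sub_val (x - y) = sub_val x - sub_val y.
  exact: (raddfB (val : S -> H)).
have E (x y : S) : nrm b (x - y) = hnrm (sub_val x - sub_val y) by rewrite -B.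
have [m n|l Hl] := @hilbert_complete _ H (fun n => sub_val (u n)) 1.
  by rewrite mul1r -E.
have Ml : M l.
  have [_ _] := M_closed; apply => n; exists (sub_val (u n)).
    by rewrite -closed_subE; exact: sub_valP.
  by rewrite hnrmB -[harm _ _]mul1r.
have Ml' : sub_mem closed_sub l by rewrite closed_subE.
by exists (to_sub Ml'), 1 => n; rewrite E.
Qed.

Definition hsub : hilbert R := hilbert_of b_linear b_herm b_pos b_complete.

Lemma projector : exists P : {linear H -> hsub},
  (forall f z, M z -> hdot H (sub_val (P f : S)) z = hdot H f z) /\
  forall f, hdot hsub (P f) (P f) <= hdot H f f.
Proof.
have /choice[p Hp] f : exists p : S, forall z, M z -> hdot H (f - sub_val p) z = 0.
  have [g Mg h] := projection f M_closed.
  have Mg' : sub_mem closed_sub g by rewrite closed_subE.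
  by exists (to_sub Mg').
have p_eq f z : M z -> hdot H (sub_val (p f)) z = hdot H f z.
  by move=> /(Hp f) /eqP; rewrite linearBl subr_eq0 => /eqP.
have Mp (x : S) : M (sub_val x) by rewrite -closed_subE; exact: sub_valP.
have p_lin : linear (p : H -> hsub).
  move=> a x y; apply/eqP; rewrite -subr_eq0; apply/eqP.
  (* The defect of linearity lies in [M] and is orthogonal to [M]. *)
  set w := _ - _; have [//|/b_pos] := eqVneq w 0.
  have -> : b w w = 0; last by rewrite ltxx.
  have ew : sub_val w = sub_val (p (a *: x + y)) - (a *: sub_val (p x) + sub_val (p y)).
    rewrite -sub_val_linear; exact: (raddfB (val : S -> H)).
  have -> : b w w =
      hdot H (sub_val (p (a *: x + y)) - (a *: sub_val (p x) + sub_val (p y))) (sub_val w).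
    by rewrite -ew.
  by rewrite hdotBl hdotDl hdotZl !(p_eq _ _ (Mp w)) hdotDl hdotZl subrr.
exists (linear_of p_lin); split=> [|f] /=; first exact: p_eq.
rewrite -[X in X <= _]/(hdot H (sub_val (p f)) (sub_val (p f))).
have e : hdot H (f - sub_val (p f)) (sub_val (p f)) = 0 by apply: Hp; exact: Mp.
move: e; generalize (sub_val (p f)) => q e.
rewrite -[X in _ <= hdot _ X X](subrK q) hdotDl hdotDr [hdot _ q (_ + q)]hdotDr.
by rewrite e addr0 [hdot H q (f - _)]hdotC e conjC0 add0r lerDr hdot_ge0.
Qed.

End ClosedSubspace.

(** * Extension of an isometry by density *)

Section IsometryExtension.
Variables (R : realType) (X : lmodType R[i]) (H Z : hilbert R).
Variables (j : {linear X -> H}) (J : {linear X -> Z}).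
Hypothesis j_dense : forall x n, exists h, hnrm (x - j h) <= harm R n.
Hypothesis J_iso : forall h g, hdot Z (J h) (J g) = hdot H (j h) (j g).

(** The image of x is described by its distances: it is as far from every [J h] as x is from [j h].
    Density makes this a complete description, and linearity follows by approximation. *)
Lemma extend_isometry : exists I : {linear H -> Z},
  (forall h, I (j h) = J h) /\ forall x y, hdot Z (I x) (I y) = hdot H x y.
Proof.
have nJ h g : hnrm (J h - J g) = hnrm (j h - j g).
  by rewrite /hnrm /nrm -!linearB J_iso.
have /choice[I HI] x : exists z, forall h, hnrm (z - J h) = hnrm (x - j h).
  have /choice[u Hu] := j_dense x.
  have [m n|z Hz] := @hilbert_complete _ Z (J \o u) 1.
    rewrite mul1r /= nJ; apply: le_trans (hnrm_tri x _ _) _.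
    by rewrite hnrmB; apply: lerD.
  exists z => h; apply/le_anti/andP; split; apply: (@le_harm _ _ _ 2) => n.
    have := hnrm_tri (J (u n)) z (J h); rewrite nJ.
    have := hnrm_tri x (j (u n)) (j h).
    have := hnrmB (j (u n)) x; have := hnrmB (J (u n)) z.
    by have := Hz n; have := Hu n; rewrite /=; lra.
  have := hnrm_tri (j (u n)) x (j h); rewrite -nJ.
  have := hnrm_tri z (J (u n)) (J h).
  by have := Hz n; have := Hu n; rewrite /=; lra.
have I_lin : linear I.
  move=> a x y; apply/eqP; rewrite -subr_eq0; apply/eqP.
  apply: (@hnrm_lim_eq0 _ _ _ (2 * (cabs a + 1))) => n.
  have [h Hh] := j_dense x n; have [g Hg] := j_dense y n.
  have e (V : hilbert R) (p q s t : V) :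
      hnrm (a *: p + q - (a *: s + t)) <= cabs a * hnrm (p - s) + hnrm (q - t).
    have -> : a *: p + q - (a *: s + t) = a *: (p - s) + (q - t).
      by rewrite opprD addrACA scalerBr.
    by apply: le_trans (hnrmD _ _) _; rewrite hnrmZ.
  have := hnrm_tri (J (a *: h + g)) (I (a *: x + y)) (a *: I x + I y).
  rewrite [hnrm (J _ - _)]hnrmB HI (linearP j) (linearP J).
  have := e _ x y (j h) (j g); have := e _ (I x) (I y) (J h) (J g); rewrite !HI.
  have : cabs a * hnrm (x - j h) <= cabs a * harm R n by rewrite ler_wpM2l ?cabs_ge0.
  lra.
exists (linear_of I_lin); split=> [h|x y] /=.
  by apply/eqP; rewrite -subr_eq0; apply/eqP/hnrm_eq0; rewrite HI subrr hnrm0.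
have nI x' : hnrm (I x') = hnrm x' by have := HI x' 0; rewrite (linear0 j) (linear0 J) !subr0.
(* Norms determine the real part of the inner product; the imaginary part is the real part at 'i
   y. *)
have re a b : complex.Re (hdot Z (I a) (I b)) = complex.Re (hdot H a b).
  have := hnrmD2 (I a) (I b).
  have -> : I a + I b = I (a + b) by rewrite -[a + b](congr2 +%R (scale1r a) erefl) I_lin scale1r.
  by rewrite !nI hnrmD2; lra.
have iZ a b : I (a *: b) = a *: I b.
  have I0 : I 0 = 0 by apply: hnrm_eq0; rewrite nI hnrm0.
  by rewrite -[a *: b]addr0 I_lin I0 addr0.
have := re x y; have := re x ('i *: y).
rewrite iZ !hdotZr -complexiE.
case: (hdot Z _ _) => p q; case: (hdot H _ _) => p' q' /= h1 h2.
by apply/eqP; rewrite eq_complex /=; apply/andP; split; apply/eqP; lra.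
Qed.

End IsometryExtension.

(** * Completion of a nonnegative form *)

Section Completion.
Variables (R : realType) (X : lmodType R[i]).
Local Notation C := R[i].
Variable K : {bilinear X -> X -> C | *%R & (conjC \; *%R)}.
Hypothesis K_ge0 : forall x, 0 <= K x x.
Local Notation q := (nrm K).
Implicit Types (f : X -> C^o) (h g : X).

Let q_ge0 g : 0 <= q g := nrm_ge0 K g.

(* [f] stands for the antilinear functional [K x] of a point [x] of the
   completion; [approx f h e] then means that [x] and [h] are at distance at
   most [e]. *)
Definition approx f h (e : R) := forall g, cabs (f g - K h g) <= e * q g.

Let approxW f h e e' : e <= e' -> approx f h e -> approx f h e'.
Proof. by move=> ee' fh g; apply: le_trans (fh g) _; rewrite ler_wpM2r. Qed.

Let approx_lin a f1 f2 h1 h2 e1 e2 : approx f1 h1 e1 -> approx f2 h2 e2 ->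
  approx (a *: f1 + f2) (a *: h1 + h2) (cabs a * e1 + e2).
Proof.
move=> fh1 fh2 g.
have -> : (a *: f1 + f2) g - K (a *: h1 + h2) g = a * (f1 g - K h1 g) + (f2 g - K h2 g).
  rewrite linearPl -[(a *: f1 + f2) g]/(a * f1 g + f2 g) /=; ring.
apply: le_trans (cabsD _ _) _; rewrite cabsM.
have := fh2 g; have : cabs a * cabs (f1 g - K h1 g) <= cabs a * (e1 * q g).
  by rewrite ler_wpM2l ?cabs_ge0.
lra.
Qed.

Let approx_self h : approx (K h) h 0.
Proof. by move=> g; rewrite subrr cabs0 mul0r. Qed.

(** The functional is tested on k = h - h' itself, where K k k is a difference of the two errors. *)
Let approx_dist f h h' e e' : 0 <= e -> 0 <= e' ->
  approx f h e -> approx f h' e' -> q (h - h') <= e + e'.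
Proof.
move=> e0 e'0 fh fh'; set k := h - h'.
have h1 : q k ^+ 2 <= (e + e') * q k.
  have <- : cabs (K k k) = q k ^+ 2.
    by rewrite (nrmE K_ge0) cabs_real ger0_norm ?sqr_ge0.
  have -> : K k k = (f k - K h' k) - (f k - K h k) by rewrite {1}/k linearBl; ring.
  apply: le_trans (cabsD _ _) _; rewrite cabsN.
  by have := fh k; have := fh' k; lra.
have [->|qN0] := eqVneq (q k) 0; first exact: addr_ge0.
by have : 0 < q k; [rewrite lt_def qN0 q_ge0 | nra].
Qed.

Let approx_form f f' h h' k k' e e' : 0 <= e -> 0 <= e' ->
  approx f h e -> approx f h' e' -> approx f' k e -> approx f' k' e' ->
  cabs (K h k - K h' k') <= (e + e') * (q k + q h').
Proof.
move=> e0 e'0 fh fh' fk fk'.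
have -> : K h k - K h' k' = K (h - h') k + K h' (k - k').
  by rewrite linearBl linearBr /=; ring.
apply: le_trans (cabsD _ _) _.
have := CauchySchwarz_psd K_ge0 (h - h') k.
have := CauchySchwarz_psd K_ge0 h' (k - k').
have : q (h - h') * q k <= (e + e') * q k.
  by rewrite ler_wpM2r//; exact: approx_dist fh fh'.
have : q h' * q (k - k') <= q h' * (e + e').
  by rewrite ler_wpM2l//; exact: approx_dist fk fk'.
lra.
Qed.

Let approx_bound f h h' e e' : 0 <= e -> 0 <= e' ->
  approx f h e -> approx f h' e' -> q h <= q h' + (e + e').
Proof.
move=> e0 e'0 fh fh'; have := nrmD K_ge0 h' (h - h'); rewrite subrKC.
by have := approx_dist e0 e'0 fh fh'; lra.
Qed.

Let approximable f := forall n, exists h, approx f h (harm R n).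

Let approximable0 : approximable 0.
Proof.
move=> n; exists 0 => g; rewrite linear0l subr0 cabs0.
by rewrite mulr_ge0 ?harm_ge0.
Qed.

Let approximable_pos f (e : R) : approximable f -> 0 < e -> exists h, approx f h e.
Proof.
by move=> fM /harm_lt[n ne]; have [h fh] := fM n; exists h; exact: approxW (ltW ne) fh.
Qed.

Let approximable_lin a f1 f2 : approximable f1 -> approximable f2 ->
  approximable (a *: f1 + f2).
Proof.
move=> f1M f2M n.
have n0 := harm_gt0 R n; have a0 := cabs_ge0 a.
have [|h1 fh1] := @approximable_pos f1 (harm R n / (2 * (cabs a + 1))) f1M.
  by rewrite divr_gt0//; lra.
have [|h2 fh2] := @approximable_pos f2 (harm R n / 2) f2M; first by rewrite divr_gt0.
exists (a *: h1 + h2); apply: approxW (approx_lin a fh1 fh2).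
have : cabs a * (harm R n / (2 * (cabs a + 1))) <= harm R n / 2.
  rewrite mulrA ler_pdivrMr; last lra.
  by rewrite -subr_ge0 [X in 0 <= X](_ : _ = harm R n); [exact: ltW | field].
lra.
Qed.

Let approximable_self h : approximable (K h).
Proof. by move=> n; exists h; apply: approxW (approx_self h); exact: harm_ge0. Qed.

Definition functional_space : subspace (X -> C^o) :=
  Subspace approximable0 approximable_lin.

(** A quantitative form of: K h k tends to l as h and k approach f and f'. The term e^2 is there
    because the seminorms of the approximants may themselves grow by e. *)
Let is_dot f f' l := exists c, forall e h k, 0 <= e ->
  approx f h e -> approx f' k e -> cabs (K h k - l) <= e * (c + e).

Let harm_le1 n : harm R n <= 1.
Proof. by rewrite /harm invf_le1 ?ltr0n// ler1n. Qed.

Let le_harmM c n : harm R n * (c + harm R n) <= harm R n * (`|c| + 1).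
Proof. by rewrite ler_wpM2l ?harm_ge0// lerD// ler_norm. Qed.

Let is_dot_ex f f' : approximable f -> approximable f' -> exists l, is_dot f f' l.
Proof.
move=> /choice[u Hu] /choice[v Hv].
(* All rates are at most 1, so each approximant exceeds the first one by at most 2 in seminorm; 4
   serves both sequences. *)
pose c := q (u 0%N) + q (v 0%N) + 4.
have qu n : q (u n) <= q (u 0%N) + 2.
  have := approx_bound (harm_ge0 R n) (harm_ge0 R 0) (Hu n) (Hu 0%N).
  by have := harm_le1 n; have := harm_le1 0; lra.
have qv n : q (v n) <= q (v 0%N) + 2.
  have := approx_bound (harm_ge0 R n) (harm_ge0 R 0) (Hv n) (Hv 0%N).
  by have := harm_le1 n; have := harm_le1 0; lra.
have [m n|l Hl] := @complex_complete _ (fun n => K (u n) (v n)) c.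
  have := approx_form (harm_ge0 R m) (harm_ge0 R n) (Hu m) (Hu n) (Hv m) (Hv n).
  move=> /le_trans; apply; rewrite mulrC ler_wpM2r ?addr_ge0 ?harm_ge0//.
  by have := qu n; have := qv m; rewrite /c; lra.
exists l, c => e h k e0 fh fk; apply: (@le_harm _ _ _ (2 * c + e)) => n.
have n0 := harm_ge0 R n; have n1 := harm_le1 n.
have := approx_form e0 n0 fh (Hu n) fk (Hv n).
have qk := approx_bound e0 (harm_ge0 R 0) fk (Hv 0%N).
have : (e + harm R n) * (q k + q (u n)) <= (e + harm R n) * (c + e).
  apply: ler_wpM2l; first exact: addr_ge0.
  by have := qu n; have := harm_le1 0; rewrite /c; lra.
have := cabsD (K h k - K (u n) (v n)) (K (u n) (v n) - l); rewrite subrKA.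
have := Hl n => /=; nra.
Qed.

Let is_dot_uniq f f' l l' : approximable f -> approximable f' ->
  is_dot f f' l -> is_dot f f' l' -> l = l'.
Proof.
move=> fM f'M [c Hl] [c' Hl']; apply/eqP; rewrite -subr_eq0; apply/eqP.
apply: (@cabs_eq0_harm _ _ (`|c| + `|c'| + 2)) => n.
have [h fh] := fM n; have [k fk] := f'M n.
have n0 := harm_ge0 R n; have n1 := harm_le1 n.
have := cabsD (l - K h k) (K h k - l'); rewrite subrKA (cabsB l (K h k)).
have := Hl _ _ _ n0 fh fk; have := Hl' _ _ _ n0 fh fk.
by have := le_harmM c n; have := le_harmM c' n; lra.
Qed.

Let S := sub_space functional_space.

Let SP (x : S) : approximable (sub_val x) := sub_valP x.

Let b (x y : S) : C := projT1 (cid (is_dot_ex (SP x) (SP y))).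

Let bP x y : is_dot (sub_val x) (sub_val y) (b x y).
Proof. exact: projT2 (cid _). Qed.

Let b_eq x y l : is_dot (sub_val x) (sub_val y) l -> b x y = l.
Proof. by move=> h; apply: is_dot_uniq (SP x) (SP y) (bP x y) h. Qed.

Let b_linear a x y z : b (a *: x + y) z = a * b x z + b y z.
Proof.
have [c1 H1] := bP x z; have [c2 H2] := bP y z; have [c Hc] := bP (a *: x + y) z.
apply/eqP; rewrite -subr_eq0; apply/eqP.
set m := cabs a; have m0 : 0 <= m := cabs_ge0 a.
apply: (@cabs_eq0_harm _ _ ((m + 1) * (`|c| + (m + 1)) + m * (`|c1| + 1) + (`|c2| + 1))) => n.
have n0 := harm_ge0 R n; have n1 := harm_le1 n.
have [h1 fh1] := SP x n; have [h2 fh2] := SP y n; have [k fk] := SP z n.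
have E0 : 0 <= m * harm R n + harm R n by rewrite addr_ge0// mulr_ge0.
have fh := approx_lin a fh1 fh2; rewrite -sub_val_linear -/m in fh.
have fk' : approx (sub_val z) k (m * harm R n + harm R n).
  by apply: approxW fk; rewrite lerDr mulr_ge0.
have := Hc _ _ _ E0 fh fk'; have := H1 _ _ _ n0 fh1 fk; have := H2 _ _ _ n0 fh2 fk.
set L := b (a *: x + y) z; rewrite linearPl /= => A2 A1 A.
have -> : L - (a * b x z + b y z) =
  (a * (K h1 k - b x z) + (K h2 k - b y z)) - (a * K h1 k + K h2 k - L) by ring.
apply: le_trans (cabsD _ _) _; rewrite cabsN.
have := cabsD (a * (K h1 k - b x z)) (K h2 k - b y z); rewrite cabsM -/m.
have : m * cabs (K h1 k - b x z) <= m * (harm R n * (`|c1| + 1)).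
  by rewrite ler_wpM2l//; apply: le_trans A1 _; exact: le_harmM.
have := le_harmM c2 n.
have : (m * harm R n + harm R n) * (c + (m * harm R n + harm R n)) <=
       (m * harm R n + harm R n) * (`|c| + (m + 1)).
  rewrite ler_wpM2l// lerD ?ler_norm//.
  by have : m * harm R n <= m; [rewrite ler_piMr | lra].
lra.
Qed.

Let b_herm x y : b x y = (b y x)^*.
Proof.
apply: b_eq; have [c Hc] := bP y x; exists c => e h k e0 fh fk.
by rewrite (psd_herm K_ge0) -rmorphB /= cabsC; exact: Hc.
Qed.

Let b_real x : exists2 r : R, b x x = r%:C%C & exists c, forall e h, 0 <= e ->
  approx (sub_val x) h e -> `|q h ^+ 2 - r| <= e * (c + e).
Proof.
have e : b x x = (complex.Re (b x x))%:C%C.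
  have := b_herm x x; case: (b x x) => r s /eqP.
  rewrite eq_complex /= => /andP[_ /eqP h]; apply/eqP; rewrite eq_complex /= eqxx /=.
  by apply/eqP; lra.
exists (complex.Re (b x x)) => //; have [c Hc] := bP x x; exists c => e' h e'0 fh.
by have := Hc _ _ _ e'0 fh fh; rewrite (nrmE K_ge0) {1}e cabs_realB.
Qed.

(** Cauchy-Schwarz between a point of the completion and a vector of X. It yields both definiteness
    and pointwise convergence of Cauchy sequences. *)
Let b_eval x (r : R) g : b x x = r%:C%C -> cabs (sub_val x g) ^+ 2 <= r * q g ^+ 2.
Proof.
have [r' -> [c Hc]] := b_real x => /complexI <- {r}.
have [h0 fh0] := SP x 0%N.
apply: (@le_harm _ _ _ ((1 + 2 * (q h0 + 2) + (`|c| + 1)) * q g ^+ 2)) => n.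
have n0 := harm_ge0 R n; have n1 := harm_le1 n.
have [h fh] := SP x n.
have qh : q h <= q h0 + 2.
  have := approx_bound n0 (harm_ge0 R 0) fh fh0; have := harm_le1 0; lra.
have xg : cabs (sub_val x g) <= (harm R n + q h) * q g.
  have := cabsD (sub_val x g - K h g) (K h g); rewrite subrK.
  have := fh g; have := CauchySchwarz_psd K_ge0 h g; lra.
have : cabs (sub_val x g) ^+ 2 <= ((harm R n + q h) * q g) ^+ 2.
  by rewrite ler_pXn2r ?nnegrE ?cabs_ge0 ?mulr_ge0 ?addr_ge0.
move/le_trans; apply; rewrite exprMn [X in _ <= _ + X]mulrAC -mulrDl ler_wpM2r ?sqr_ge0//.
have := Hc _ _ n0 fh; rewrite ler_norml => /andP[_].
have := le_harmM c n.
have : harm R n * q h <= harm R n * (q h0 + 2) by rewrite ler_wpM2l.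
have : harm R n ^+ 2 <= harm R n by rewrite ler_piMr.
rewrite sqrrD; lra.
Qed.

Let b_ge0 x : 0 <= b x x.
Proof.
have [r e [c Hc]] := b_real x; rewrite e lecE /= eqxx /=.
apply: (@le_harm _ _ _ (`|c| + 1)) => n.
have n0 := harm_ge0 R n; have n1 := harm_le1 n.
have [h fh] := SP x n; have := Hc _ _ n0 fh; rewrite ler_norml => /andP[_].
have := le_harmM c n.
by have := sqr_ge0 (q h); lra.
Qed.

Let b_pos x : x != 0 -> 0 < b x x.
Proof.
move=> x0; rewrite lt_neqAle b_ge0 andbT eq_sym; apply: contra_neq x0 => x0.
apply: sub_val_inj; transitivity (0 : X -> C^o); last exact/esym/(raddf0 (val : S -> _)).
apply/funext => g; apply: cabs_eq0; apply/eqP; rewrite -sqrf_eq0; apply/eqP/le_anti.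
by rewrite sqr_ge0 andbT; have := @b_eval x 0 g x0; rewrite mul0r.
Qed.

Let b_le x h (e : R) : 0 <= e -> approx (sub_val x) h e -> nrm b x <= q h + e.
Proof.
move=> e0 fh; have [r er [c Hc]] := b_real x.
rewrite -(@ler_pXn2r _ 2) ?nnegrE ?addr_ge0 ?sqrtr_ge0//.
rewrite sqr_sqrtr; last by have [] := ge0_Re (b_ge0 x).
rewrite er /=; apply: (@le_harm _ _ _ (2 * (q h + e) + 1 + (`|c| + 1))) => n.
have n0 := harm_ge0 R n; have n1 := harm_le1 n.
have [k fk] := SP x n; have := Hc _ _ n0 fk; rewrite ler_norml => /andP[+ _].
have := le_harmM c n.
have qk := approx_bound n0 e0 fk fh.
have : q k ^+ 2 <= (q h + (harm R n + e)) ^+ 2.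
  by rewrite ler_pXn2r ?nnegrE ?addr_ge0.
have -> : (q h + (harm R n + e)) ^+ 2 =
    (q h + e) ^+ 2 + 2 * (q h + e) * harm R n + harm R n ^+ 2 by ring.
have : harm R n ^+ 2 <= harm R n by rewrite ler_piMr.
lra.
Qed.

Let b_complete (u : nat -> S) :
  (forall m n, nrm b (u m - u n) <= harm R m + harm R n) ->
  exists l c, forall n, nrm b (u n - l) <= c * harm R n.
Proof.
move=> Hu.
have B (x y : S) : sub_val (x - y) = sub_val x - sub_val y.
  exact: (raddfB (val : S -> _)).
have ev m n g : cabs (sub_val (u m) g - sub_val (u n) g) <= q g * (harm R m + harm R n).
  rewrite -[_ - _]/((sub_val (u m) - sub_val (u n)) g) -B.
  have [e re] := ge0_Re (b_ge0 (u m - u n)).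
  have := b_eval g e; have := Hu m n; rewrite -(sqr_sqrtr re) -/(nrm b _) => h1 h2.
  have : cabs (sub_val (u m - u n) g) <= nrm b (u m - u n) * q g.
    by rewrite -(@ler_pXn2r _ 2) ?nnegrE ?cabs_ge0 ?mulr_ge0 ?sqrtr_ge0// exprMn.
  by have := q_ge0 g; nra.
have /choice[f Hf] g : exists l, forall n, cabs (sub_val (u n) g - l) <= q g * harm R n.
  by apply: complex_complete => m n; exact: ev.
have fM : approximable f.
  (* Half of the error goes to replacing f by [u m], the other half to replacing [u m] by a vector
     of X. *)
  move=> n; have [m hm] := harm_lt (divr_gt0 (harm_gt0 R n) (ltr0n R 2)).
  have [h uh] := SP (u m) m; exists h => g.
  have := cabsD (f g - sub_val (u m) g) (sub_val (u m) g - K h g).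
  rewrite subrKA (cabsB (f g) (sub_val (u m) g)).
  have := Hf g m; have := uh g; have : q g * harm R m <= q g * (harm R n / 2).
    by rewrite ler_wpM2l// ltW.
  lra.
pose x : S := to_sub (fM : sub_mem functional_space f).
(* [0] approximates [u n - x] up to [harm R n], so [b_le] bounds the norm. *)
exists x, 1 => n; rewrite mul1r.
have := @b_le (u n - x) 0 (harm R n) (harm_ge0 R n); rewrite (nrm0 K_ge0) add0r; apply.
by move=> g; rewrite linear0l subr0 B mulrC; exact: Hf.
Qed.

Let Hs : hilbert R := hilbert_of b_linear b_herm b_pos b_complete.

(** Sending h to the functional [K h] divides out the null vectors by itself: by Cauchy-Schwarz they
    give the zero functional. *)
Theorem psd_completion : exists (H : hilbert R) (j : {linear X -> H}),
  (forall h g, hdot H (j h) (j g) = K h g) /\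
  forall x n, exists h, hnrm (x - j h) <= harm R n.
Proof.
pose j h : S := to_sub (approximable_self h : sub_mem functional_space (K h)).
have j_lin : linear (j : X -> Hs).
  move=> a x y; apply: sub_val_inj; rewrite sub_val_linear.
  by apply/funext => g; exact: linearPl.
exists Hs, (linear_of j_lin); split=> [h g|x n] /=.
  apply: (@b_eq (j h) (j g)).
  exists (q h + q g) => e h' g' e0 fh fg.
  have := approx_form e0 (lexx 0) fh (approx_self h) fg (approx_self g).
  rewrite addr0; move/le_trans; apply; rewrite ler_wpM2l//.
  have := approx_bound e0 (lexx 0) fg (approx_self g); lra.
have [h xh] := SP x n; exists h.
have := @b_le (x - j h) 0 (harm R n) (harm_ge0 R n); rewrite (nrm0 K_ge0) add0r; apply.
move=> g; rewrite linear0l subr0; have := xh g.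
have -> : sub_val (x - j h) = sub_val x - K h by exact: (raddfB (val : S -> _)).
by [].
Qed.

End Completion.

(** * Symmetric and selfadjoint relations *)

Section SymmetricRelations.
Variables (R : realType) (V : hilbert R).
Local Notation C := R[i].
Local Notation adj := (adjoint_rel (hdot V)).
Implicit Types (A B T : set (V * V)) (l : C).

Lemma adj_sub A B : A `<=` B -> adj B `<=` adj A.
Proof. by move=> AB f Bf g Ag; apply/Bf/AB. Qed.

Lemma sub_adj_adj A : A `<=` adj (adj A).
Proof. by move=> f Af g /(_ f Af) h; rewrite hdotC -h -hdotC. Qed.

Lemma adj_adj_adj A : adj (adj (adj A)) = adj A.
Proof.
apply/seteqP; split; last exact: sub_adj_adj.
exact: adj_sub (@sub_adj_adj A).
Qed.

Lemma adj_linear A a f g : adj A f -> adj A g -> adj A (a *: f + g).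
Proof.
by move=> Af Ag h Ah; rewrite /= !hdotDl !hdotZl Af// Ag.
Qed.

Lemma adj0 A : adj A 0.
Proof. by move=> h _; rewrite /= !hdot0l. Qed.

Lemma adjN A f : adj A f -> adj A (- f).
Proof.
by move=> Af; have := adj_linear (-1) Af (@adj0 A); rewrite scaleN1r addr0.
Qed.

Lemma adjB A f g : adj A f -> adj A g -> adj A (f - g).
Proof.
by move=> Af Ag; have := adj_linear (-1) Ag Af; rewrite scaleN1r addrC.
Qed.

Lemma adj_closed A (f : V * V) (c : R) :
  (forall n, exists2 g, adj A g &
    hnrm (f.1 - g.1) <= c * harm R n /\ hnrm (f.2 - g.2) <= c * harm R n) -> adj A f.
Proof.
move=> Hf a Aa; apply/eqP; rewrite -subr_eq0; apply/eqP.
apply: (@cabs_eq0_harm _ _ (c * (hnrm a.1 + hnrm a.2))) => n.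
have [g Ag [h1 h2]] := Hf n.
have -> : hdot V f.2 a.1 - hdot V f.1 a.2 = hdot V (f.2 - g.2) a.1 - hdot V (f.1 - g.1) a.2.
  by rewrite !hdotBl (Ag a Aa); ring.
apply: le_trans (cabsD _ _) _; rewrite cabsN.
have := CauchySchwarz_hdot (f.2 - g.2) a.1; have := CauchySchwarz_hdot (f.1 - g.1) a.2.
have : hnrm (f.1 - g.1) * hnrm a.2 <= c * harm R n * hnrm a.2.
  by rewrite ler_wpM2r ?hnrm_ge0.
have : hnrm (f.2 - g.2) * hnrm a.1 <= c * harm R n * hnrm a.1.
  by rewrite ler_wpM2r ?hnrm_ge0.
lra.
Qed.

(** The hypothesis makes <x', x> real, so the imaginary part of <x' - l x, x> is -Im l |x|^2;
    Cauchy-Schwarz does the rest. *)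
Lemma sym_bound (x x' : V) l : hdot V x' x = hdot V x x' ->
  `|complex.Im l| * hnrm x <= hnrm (x' - l *: x).
Proof.
move=> sym; have r : complex.Im (hdot V x' x) = 0.
  have : hdot V x' x = (hdot V x' x)^* by rewrite -hdotC.
  by case: (hdot V x' x) => a b /eqP; rewrite eq_complex /= => /andP[_ /eqP]; lra.
have [->|x0] := eqVneq (hnrm x) 0; first by rewrite mulr0 hnrm_ge0.
have xp : 0 < hnrm x by rewrite lt_def x0 hnrm_ge0.
rewrite -(ler_pM2r xp); apply: le_trans (CauchySchwarz_hdot _ _).
apply: le_trans (Im_cabs _); rewrite hdotBl hdotZl hnrmE raddfB /= r sub0r normrN.
by rewrite ImM_real normrM [X in _ <= _ * X]ger0_norm ?sqr_ge0// expr2 mulrA.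
Qed.

Lemma nonreal_gt0 l : nonreal l -> 0 < `|complex.Im l|.
Proof. by rewrite normr_gt0. Qed.

Lemma nonreal_conj l : nonreal l -> nonreal l^*.
Proof. by rewrite /nonreal Im_conj oppr_eq0. Qed.

(** The range of S - l is closed and its orthogonal complement lies in the kernel of S^* - l^*.
    Taking S as an adjoint makes it linear and closed. *)
Lemma range_full B l : nonreal l -> let S := adj B in S `<=` adj S ->
  (forall x, adj S (x, l^* *: x) -> x = 0) ->
  forall y, exists x, S (x, y + l *: x).
Proof.
move=> l0 S symS kerS y; have c0 := nonreal_gt0 l0; set c := `|_| in c0.
pose M := [set z | exists x, S (x, z + l *: x)].
have clM : closed_subspace M.
  split=> [|a x1 x2 [z1 S1] [z2 S2]|z Hz].
  - by exists 0; rewrite scaler0 addr0; exact: adj0.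
  - exists (a *: z1 + z2).
    have : S (a *: z1 + z2, a *: (x1 + l *: z1) + (x2 + l *: z2)) := adj_linear a S1 S2.
    by congr (S (_, _)); rewrite !scalerDr !scalerA mulrC addrACA.
  (* By [sym_bound] the preimages of a convergent sequence are Cauchy, at the price of the factor
     1/|Im l|. *)
  - have /choice[u Hu] n : exists x, exists2 w, S (x, w + l *: x) & hnrm (z - w) <= harm R n.
      by have [w [x Sx] zw] := Hz n; exists x, w.
    have [m n|x Hx] := @hilbert_complete _ V u c^-1.
      have [w1 S1 h1] := Hu m; have [w2 S2 h2] := Hu n.
      rewrite mulrC ler_pdivlMr// mulrC.
      have S12 : S (u m - u n, (w1 + l *: u m) - (w2 + l *: u n)).
        exact: (adjB S1 S2).
      have := @sym_bound _ _ l (symS _ S12 _ S12) => /le_trans; apply => /=.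
      have -> : w1 + l *: u m - (w2 + l *: u n) - l *: (u m - u n) = w1 - w2.
        by rewrite scalerBr opprD addrACA addrK.
      apply: le_trans (hnrm_tri z _ _) _; rewrite (hnrmB w1); exact: lerD.
    exists x; apply: (@adj_closed _ _ (c^-1 + 1 + cabs l * c^-1)) => n.
    have [w Sw zw] := Hu n; exists (u n, w + l *: u n) => //=.
    have h := Hx n; rewrite hnrmB in h; have n0 := harm_ge0 R n.
    have ci : 0 <= c^-1 by rewrite invr_ge0 ltW.
    have lc : 0 <= cabs l * c^-1 by rewrite mulr_ge0 ?cabs_ge0.
    split.
      by apply: le_trans h _; rewrite ler_wpM2r//; lra.
    have -> : z + l *: x - (w + l *: u n) = (z - w) + l *: (x - u n).
      by rewrite scalerBr opprD addrACA.
    apply: le_trans (hnrmD _ _) _; rewrite hnrmZ.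
    have : cabs l * hnrm (x - u n) <= cabs l * (c^-1 * harm R n).
      by rewrite ler_wpM2l ?cabs_ge0.
    by nra.
have [g Mg gP] := projection y clM.
suff e : y - g = 0 by move/eqP: e; rewrite subr_eq0 => /eqP ->.
(* Orthogonality of y - g to every x' - l x says that (y - g, l^* (y - g)) is in the adjoint of
   S. *)
apply: kerS => -[x x'] Sx /=.
have Mx : M (x' - l *: x) by exists x; rewrite subrK.
have := gP _ Mx; rewrite hdotBr hdotZr => /eqP; rewrite subr_eq0 => /eqP ->.
by rewrite hdotZl.
Qed.

Lemma selfadjoint_adj T : selfadjoint_rel (hdot V) T -> adj T = T.
Proof. by move=> <-. Qed.

Lemma selfadjoint_range T l y : selfadjoint_rel (hdot V) T -> nonreal l ->
  exists x, T (x, y + l *: x).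
Proof.
move=> saT l0; have aT := selfadjoint_adj saT.
have := @range_full T l l0; rewrite /= !aT; apply=> [//|x Tx].
have sym : adj T (x, l^* *: x) by rewrite aT.
have {}sym := sym _ Tx.
have := sym_bound l^* sym.
rewrite subrr hnrm0 pmulr_rle0 ?nonreal_gt0//; last exact: nonreal_conj.
by move=> h; apply: hnrm_eq0; apply/le_anti; rewrite h hnrm_ge0.
Qed.

Lemma selfadjoint_uniq T l y x1 x2 : selfadjoint_rel (hdot V) T -> nonreal l ->
  T (x1, y + l *: x1) -> T (x2, y + l *: x2) -> x1 = x2.
Proof.
move=> saT l0; have aT := selfadjoint_adj saT; rewrite -aT => T1 T2.
have := adjB T1 T2; rewrite /GRing.add /= /GRing.opp /= => T12.
have sym := T12; rewrite aT in sym; have {}sym := T12 _ sym.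
have := sym_bound l sym => /=.
rewrite opprD addrACA subrr add0r -scalerBr subrr hnrm0 pmulr_rle0 ?nonreal_gt0//.
move=> h; apply/eqP; rewrite -subr_eq0; apply/eqP/hnrm_eq0/le_anti.
by rewrite h hnrm_ge0.
Qed.

Lemma resolventP T l y : selfadjoint_rel (hdot V) T -> nonreal l ->
  T (resolvent T l y, y + l *: resolvent T l y).
Proof.
move=> saT l0; have [x Tx] := selfadjoint_range y saT l0.
exact: (@xgetPex _ 0 [set x | T (x, y + l *: x)] (ex_intro _ x Tx)).
Qed.

Lemma resolvent_eq T l y x : selfadjoint_rel (hdot V) T -> nonreal l ->
  T (x, y + l *: x) -> resolvent T l y = x.
Proof.
by move=> saT l0 Tx; exact: selfadjoint_uniq saT l0 (resolventP y saT l0) Tx.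
Qed.

(** For (x, x') in E^*, solve (S - l) z = x' - l x in S = E^**, a part of E^*. Then x - z is an
    eigenvector of E^* at l, hence 0, and (x, x') is in S. *)
Lemma essentially_selfadjoint E : E `<=` adj E ->
  (forall l, nonreal l -> forall x, adj E (x, l *: x) -> x = 0) ->
  selfadjoint_rel (hdot V) (adj E).
Proof.
move=> symE kerE; pose l : C := 'i%C.
have l0 : nonreal l by rewrite /nonreal /= oner_neq0.
have subS : adj (adj E) `<=` adj E by exact: adj_sub.
rewrite /selfadjoint_rel; apply/seteqP; split; last exact: subS.
move=> [x x'] Ex.
have symS : adj (adj E) `<=` adj (adj (adj E)) by rewrite adj_adj_adj.
have [|z Sz] := range_full l0 symS _ (x' - l *: x).
  by move=> z; rewrite adj_adj_adj; exact/kerE/nonreal_conj.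
suff xz : x = z by move: Sz; rewrite -xz subrK.
apply/eqP; rewrite -subr_eq0; apply/eqP; apply: (kerE l l0).
have := adjB Ex (subS _ Sz); congr (adj E (_, _)) => /=.
by rewrite opprD addrA subKr scalerBr.
Qed.

End SymmetricRelations.

(** * Selfadjoint extensions of a symmetric relation by doubling *)

Section ExitExtension.
Variables (R : realType) (V : hilbert R) (A : set (V * V)).
Local Notation adj := (adjoint_rel (hdot V)).

(* Selfadjoint extension of [A (+) -A] in [V (+) V], which has equal deficiency
   indices.  With [a = (x.1, x'.1)] and [p = (x.2, - x'.2)], both in [A^*], the
   boundary form is [[a, a] - [p, p]], and it vanishes when [a - p] is in
   [A^**]. *)
Definition exit_rel : set (hsum V V * hsum V V) := [set f |
  [/\ adj A (f.1.1, f.2.1), adj A (f.1.2, - f.2.2) &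
      adj (adj A) (f.1.1 - f.1.2, f.2.1 + f.2.2)]].

Lemma exit_rel_extends x x' : A `<=` adj A -> A (x, x') -> exit_rel ((x, 0), (x', 0)).
Proof.
move=> symA Ax; split=> /=; first exact: symA.
- by rewrite oppr0; exact: adj0.
- by rewrite subr0 addr0; exact: sub_adj_adj.
Qed.

Lemma exit_rel_selfadjoint : A `<=` adj A -> selfadjoint_rel (hdot (hsum V V)) exit_rel.
Proof.
move=> symA; have symS : adj (adj A) `<=` adj A by exact: adj_sub.
apply/seteqP; split.
  move=> [[x y] [x' y']] [/= ha hp hap] [[u v] [u' v']] [/= ha2 hp2 hap2].
  rewrite -[LHS]/(hdot V x' u + hdot V y' v) -[RHS]/(hdot V x u' + hdot V y v').
  (* Each difference a - p is in A^** and is paired with a component of the other element: with its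
     a in [e1], with its p in [e2]. *)
  have e1 := hap _ ha2; have e2 := hap2 _ hp; rewrite /= in e1 e2.
  have : hdot V (x' + y') u - hdot V y (u' + v') = hdot V (x - y) u' - hdot V (- y') (u - v).
    by rewrite e1 [hdot V y _]hdotC e2 -hdotC.
  rewrite hdotNl !hdotBl !hdotBr !hdotDl !hdotDr => h.
  apply/eqP; rewrite -subr_eq0; apply/eqP; move/eqP: h; rewrite -subr_eq0 => /eqP <-; ring.
move=> [[x y] [x' y']] Tf.
have P u u' v v' : adj A (u, u') -> adj A (v, - v') -> adj (adj A) (u - v, u' + v') ->
   hdot V x' u + hdot V y' v = hdot V x u' + hdot V y v'.
  by move=> h1 h2 h3; exact: (Tf ((u, v), (u', v'))).
(* Three kinds of test elements recover the three clauses: A in the first copy, A in the second copy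
   up to sign, and A^* on the diagonal a = p. *)
split=> /=.
- move=> [u u'] Au; have := P u u' 0 0; rewrite !hdot0r !addr0 subr0 oppr0; apply.
  + exact: symA.
  + exact: adj0.
  + exact: sub_adj_adj.
- move=> [v v'] Av; have := P 0 0 (- v) v'; rewrite !hdot0r !add0r opprK.
  rewrite !hdotNr hdotNl => -> //.
  + exact: adj0.
  + exact: (adjN (symA _ Av)).
  + exact: sub_adj_adj.
- move=> [u u'] Au; have := P u u' u (- u').
  rewrite opprK !subrr hdotNr.
  by move=> /(_ Au Au (@adj0 _ _ _)) h; rewrite /= hdotDl hdotBl.
Qed.

End ExitExtension.

(** * Reproducing kernel spaces *)

Section ColumnForm.
Variables (R : realType) (d : nat).
Local Notation C := R[i].
Implicit Types (u v x : 'cV[C]_d) (A B : 'M[C]_d).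

Lemma cdotDl u v x : cdot (u + v) x = cdot u x + cdot v x.
Proof. exact: (@hdotDl _ (hcol R d)). Qed.

Lemma cdotBl u v x : cdot (u - v) x = cdot u x - cdot v x.
Proof. exact: (@hdotBl _ (hcol R d)). Qed.

Lemma cdotZl a u x : cdot (a *: u) x = a * cdot u x.
Proof. exact: (@hdotZl _ (hcol R d)). Qed.

Lemma cdotDr u v x : cdot x (u + v) = cdot x u + cdot x v.
Proof. exact: (@hdotDr _ (hcol R d)). Qed.

Lemma cdotBr u v x : cdot x (u - v) = cdot x u - cdot x v.
Proof. exact: (@hdotBr _ (hcol R d)). Qed.

Lemma cdotZr a u x : cdot x (a *: u) = a^* * cdot x u.
Proof. exact: (@hdotZr _ (hcol R d)). Qed.

Lemma cdot0l x : cdot 0 x = 0.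
Proof. exact: (@hdot0l _ (hcol R d)). Qed.

Lemma cdot0r x : cdot x 0 = 0.
Proof. exact: (@hdot0r _ (hcol R d)). Qed.

Lemma cdot_adjr A u v : cdot (A *m u) v = cdot u (A^t* *m v).
Proof.
rewrite /cdot trmx_mul map_mxM /= map_trmx -!map_trmx trmxK mulmxA.
by rewrite map_mxCK.
Qed.

Lemma adjmxK A : (A^t*)^t* = A.
Proof. by rewrite map_trmx trmxK map_mxCK. Qed.

Lemma cdot_adjl A u v : cdot u (A *m v) = cdot (A^t* *m u) v.
Proof. by rewrite cdot_adjr adjmxK. Qed.

Lemma cdot_delta u i : cdot u (delta_mx i 0) = u i 0.
Proof.
rewrite cdotE (bigD1 i)//= big1 => [|j ji]; rewrite mxE ?eqxx /=.
  by rewrite conjC1 mulr1 addr0.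
by rewrite (negPf ji) /= conjC0 mulr0.
Qed.

Lemma cdot_inj u v : (forall x, cdot u x = cdot v x) -> u = v.
Proof.
by move=> h; apply/matrixP => i j; rewrite ord1 -!cdot_delta.
Qed.

Lemma mulmx_delta A i j : (A *m (delta_mx j 0 : 'cV[C]_d)) i 0 = A i j.
Proof. by rewrite -colE mxE. Qed.

Lemma cdot_mx_inj A B :
  (forall u v, cdot (A *m u) v = cdot (B *m u) v) -> A = B.
Proof.
move=> h; apply/matrixP => i j; rewrite -!mulmx_delta -!cdot_delta; exact: h.
Qed.

Lemma col_delta u : u = \sum_i u i 0 *: delta_mx i 0.
Proof.
rewrite [LHS]matrix_sum_delta; apply: eq_bigr => i _.
by rewrite big_ord1.
Qed.

Lemma cdot_repr (F : 'cV[C]_d -> C) :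
  (forall a u v, F (a *: u + v) = a^* * F u + F v) ->
  exists x, forall u, cdot x u = F u.
Proof.
move=> F_lin; exists (\col_i F (delta_mx i 0)) => u.
have F0 : F 0 = 0.
  by have /eqP := F_lin 1 0 0; rewrite scaler0 addr0 conjC1 mul1r addrC -subr_eq subrr => /eqP.
have FD v w : F (v + w) = F v + F w by rewrite -[v]scale1r F_lin conjC1 mul1r scale1r.
rewrite [in RHS](col_delta u) cdotE (big_morph F FD F0); apply: eq_bigr => i _.
by have := F_lin (u i 0) (delta_mx i 0) 0; rewrite F0 !addr0 mxE mulrC => ->.
Qed.

Lemma mulmx_linear (f : 'cV[C]_d -> 'cV[C]_d) :
  (forall a u v, f (a *: u + v) = a *: f u + f v) ->
  forall u, (\matrix_(i, j) f (delta_mx j 0) i 0) *m u = f u.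
Proof.
move=> f_lin u; pose F := linear_of f_lin; rewrite -[f u]/(F u).
rewrite [in RHS](col_delta u) linear_sum; apply/matrixP => i j; rewrite ord1 mxE summxE.
by apply: eq_bigr => p _; rewrite linearZ !mxE mulrC.
Qed.

End ColumnForm.

(** * Closed spans of vector families as reproducing kernel spaces *)

Section SpanSpace.
Variables (R : realType) (d : nat) (H : hilbert R).
Local Notation C := R[i].
Variables (k : C -> C -> 'M[C]_d) (G : C -> 'cV[C]_d -> H).
Hypothesis G_linear : forall l, nonreal l ->
  forall a u v, G l (a *: u + v) = a *: G l u + G l v.
Hypothesis G_kernel : forall w l, nonreal w -> nonreal l ->
  forall u v, cdot (kernel_ext k w l *m u) v = hdot H (G w u) (G l v).

(* The space is realized as the closed span of the vectors [G l u], described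
   as a double orthogonal complement. *)
Let M : set H := [set f | forall g,
  (forall l u, nonreal l -> hdot H g (G l u) = 0) -> hdot H g f = 0].

Let M_closed : closed_subspace M.
Proof.
split=> [g _|a x y Mx My g gG|y Hy g gG]; first exact: hdot0r.
  by rewrite hdotDr hdotZr (Mx g gG) (My g gG) mulr0 addr0.
apply: (@cabs_eq0_harm _ _ (hnrm g)) => n; have [z Mz yz] := Hy n.
have -> : hdot H g y = hdot H g (y - z) by rewrite hdotBr (Mz g gG) subr0.
by apply: le_trans (CauchySchwarz_hdot _ _) _; rewrite ler_wpM2l ?hnrm_ge0.
Qed.

Let MG l u : nonreal l -> M (G l u).
Proof. by move=> l0 g; exact. Qed.

Let S := hsub M_closed.
Let val (x : S) : H := sub_val (x : sub_space (closed_sub M_closed)).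

Let Mval x : M (val x).
Proof. by rewrite -(closed_subE M_closed); exact: sub_valP. Qed.

(** The value of f at l is the Riesz vector of u |-> <f, G l u>. If all values vanish, f is
    orthogonal to the generators and so to the double complement, which contains f. [P] is the
    orthogonal projection. *)
Lemma span_rkhs : exists (S : rkhs k) (P : {linear H -> S}),
  (forall f l u, nonreal l -> cdot (rk_eval (P f) l) u = hdot H f (G l u)) /\
  forall f, hdot S (P f) (P f) <= hdot H f f.
Proof.
(* At real l the value 0 is a mere default. *)
have /choice[ev evP] (p : S * C) : exists x : 'cV[C]_d,
    nonreal p.2 -> forall u, cdot x u = hdot H (val p.1) (G p.2 u).
  case: p => f l /=; have [l0|nl0] := pselect (nonreal l); last by exists 0.
  have [|x Hx] := @cdot_repr _ d (fun u => hdot H (val f) (G l u)); last by exists x.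
  by move=> a u v; rewrite G_linear// hdotDr hdotZr.
have evE f l u : nonreal l -> cdot (ev (f, l)) u = hdot H (val f) (G l u).
  by move=> /(evP (f, l)).
have ev_lin a f g l : nonreal l -> ev (a *: f + g, l) = a *: ev (f, l) + ev (g, l).
  move=> l0; apply: cdot_inj => u; rewrite cdotDl cdotZl !evE//.
  by rewrite /val sub_val_linear hdotDl hdotZl.
have ev_inj f g : (forall l, nonreal l -> ev (f, l) = ev (g, l)) -> f = g.
  move=> fg; apply: sub_val_inj; apply/eqP; rewrite -subr_eq0 -(dnorm_eq0 (hdot H)).
  have e h : M h -> hdot H (val f - val g) h = 0.
    apply => l u l0; rewrite hdotBl -!evE// fg//; exact: subrr.
  apply/eqP; change (hdot H (val f - val g) (val f - val g) = 0).
  by rewrite hdotBr !e ?subrr//; exact: Mval.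
have ev_rep w u : nonreal w -> exists2 ku : S,
    forall l, nonreal l -> ev (ku, l) = kernel_ext k w l *m u &
    forall f, hdot S f ku = cdot (ev (f, w)) u.
  move=> w0; have Mw : sub_mem (closed_sub M_closed) (G w u).
    by rewrite closed_subE; exact: MG.
  exists (to_sub Mw) => [l l0|f]; last by rewrite evE.
  by apply: cdot_inj => v; rewrite evE// G_kernel.
pose Sk : rkhs k := @Rkhs R d k S (fun f l => ev (f, l)) ev_lin ev_inj ev_rep.
have [P [P1 P2]] := projector M_closed.
exists Sk, P; split=> [f l u l0|f]; last exact: P2.
by rewrite /= evE//; apply: P1; exact: MG.
Qed.

End SpanSpace.

(** * The kernel on the diagonal as a limit *)

Section KernelLimit.
Variable R : realType.
Local Notation C := R[i].

Lemma lipschitz_dnbhs (g : C -> C) (l c : C) (B r : R) : 0 < r ->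
  (forall z, z != l -> cabs (z - l) < r -> cabs (g z - c) <= B * cabs (z - l)) ->
  (g z : C^o) @[z --> (l : C^o)^'] --> (c : C^o).
Proof.
move=> r0 Hg; apply/cvgrPdist_lt => e e0.
have [ee er] := ge0_Re (ltW e0); have e'0 : 0 < complex.Re e.
  by move: e0; rewrite {1}ee ltcR.
pose s := Num.min r (complex.Re e / (`|B| + 1)).
have s0 : 0 < s by rewrite lt_min r0 divr_gt0// ltr_wpDl.
apply/(@nbhs_ballP C C^o); exists s%:C%C; first by rewrite /= ltcR.
move=> z; rewrite -ball_normE /= normcabs ltcR cabsB => zs zl.
rewrite normcabs ee ltcR cabsB; apply: le_lt_trans (Hg _ zl _) _.
  by apply: lt_le_trans zs _; rewrite ge_min lexx.
move: zs; rewrite lt_min ltr_pdivlMr ?ltr_wpDl// => /andP[_].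
by have := ler_norm B; have := cabs_ge0 (z - l); nra.
Qed.

End KernelLimit.

Section KernelExtension.
Variables (R : realType) (d : nat) (H : hilbert R).
Local Notation C := R[i].
Variables (k : C -> C -> 'M[C]_d) (G : C -> 'cV[C]_d -> H).
Hypothesis G_linear : forall l, nonreal l ->
  forall a u v, G l (a *: u + v) = a *: G l u + G l v.
Hypothesis G_kernel : forall w l, nonreal w -> nonreal l -> l != w^* ->
  forall u v, cdot (k w l *m u) v = hdot H (G w u) (G l v).
Hypothesis G_lipschitz : forall l v, nonreal l -> exists c, forall z, nonreal z ->
  `|complex.Im z| * hnrm (G z v - G l v) <= c * cabs (z - l).

(** Within |Im l| / 2 of l the factor |Im z| of [G_lipschitz] stays above |Im l| / 2 and can be
    divided out. *)
Lemma lipschitz_local l v : nonreal l -> exists B r, 0 < r /\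
  forall z, cabs (z - l) < r -> nonreal z /\ hnrm (G z v - G l v) <= B * cabs (z - l).
Proof.
move=> l0; have [c Hc] := G_lipschitz v l0; have y0 := nonreal_gt0 l0.
pose r := `|complex.Im l| / 2; have r0 : 0 < r by rewrite divr_gt0.
exists (c / r), r; split=> // z zl.
have zr : r < `|complex.Im z|.
  have h1 := le_lt_trans (Im_cabs _) zl; rewrite raddfB /= distrC in h1.
  have := ler_normD (complex.Im l - complex.Im z) (complex.Im z); rewrite subrK.
  move: h1; rewrite /r; lra.
have z0 : nonreal z by rewrite /nonreal -normr_gt0; exact: lt_trans zr.
split=> //; rewrite mulrAC ler_pdivlMr// mulrC; apply: le_trans (Hc z z0).
by rewrite ler_wpM2r ?hnrm_ge0// ltW.
Qed.

(** Only l = w^* needs an argument: there the Gram entries <G w u, G z v> converge as z --> l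
    because G is Lipschitz near l, and their limit is the extended kernel. *)
Lemma kernel_ext_span w l : nonreal w -> nonreal l ->
  forall u v, cdot (kernel_ext k w l *m u) v = hdot H (G w u) (G l v).
Proof.
move=> w0 l0; rewrite /kernel_ext; case: eqVneq => [lw|lw]; last exact: G_kernel.
have /choice[f Hf] u : exists x, forall v, cdot x v = hdot H (G w u) (G l v).
  by apply: cdot_repr => a u' v; rewrite G_linear// hdotDr hdotZr.
have f_lin a u v : f (a *: u + v) = a *: f u + f v.
  by apply: cdot_inj => x; rewrite cdotDl cdotZl !Hf G_linear// hdotDl hdotZl.
move=> u v; rewrite -Hf -(mulmx_linear f_lin).
apply: (f_equal (fun A => cdot (A *m u) v)); apply/matrixP => i j; rewrite !mxE.
apply: (@cvg_lim C^o); first exact: norm_hausdorff.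
have [B [r [r0 HB]]] := lipschitz_local (delta_mx i 0) l0.
apply: (lipschitz_dnbhs (B := hnrm (G w (delta_mx j 0)) * B) r0) => z zl zr.
have [z0 hz] := HB z zr.
rewrite -mulmx_delta -!cdot_delta G_kernel -?lw// Hf -hdotBr.
apply: le_trans (CauchySchwarz_hdot _ _) _; rewrite -mulrA.
by rewrite ler_wpM2l ?hnrm_ge0.
Qed.

End KernelExtension.

(** * Resolvent families of a selfadjoint relation *)

Section Resolvent.
Variables (R : realType) (d : nat) (Hs : hilbert R).
Local Notation C := R[i].
Local Notation L := ('cV[C]_d).
Local Notation V := (hsum Hs (hcol R d)).
Variable T : set ((Hs * L) * (Hs * L)).
Hypothesis T_sa : selfadjoint_rel (@sum_dot R d Hs) T.

Let saT : selfadjoint_rel (hdot V) (T : set (V * V)) := T_sa.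

Definition psi_rel l : 'M[C]_d :=
  \matrix_(i, j) (resolvent T l (0, delta_mx j 0)).2 i 0.
Definition phi_rel l : 'M[C]_d := 1%:M + l *: psi_rel l.
Definition gamma_rel l (v : L) : Hs := (resolvent T l (0, v)).1.

Lemma rel_sym (x s : Hs) (y t : L) (x' s' : Hs) (y' t' : L) :
  T ((x, y), (s, t)) -> T ((x', y'), (s', t')) ->
  hdot Hs s x' + cdot t y' = hdot Hs x s' + cdot y t'.
Proof. by move=> h1 h2; rewrite T_sa in h1; exact: (h1 _ h2). Qed.

Lemma rel_lin a (x s x' s' : Hs) (y t y' t' : L) :
  T ((x, y), (s, t)) -> T ((x', y'), (s', t')) ->
  T ((a *: x + x', a *: y + y'), (a *: s + s', a *: t + t')).
Proof.
by move=> h1 h2; rewrite T_sa in h1 h2 *; exact: (@adj_linear _ V T a _ _ h1 h2).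
Qed.

Lemma rel_sub (x s x' s' : Hs) (y t y' t' : L) :
  T ((x, y), (s, t)) -> T ((x', y'), (s', t')) ->
  T ((x - x', y - y'), (s - s', t - t')).
Proof.
by move=> h1 h2; rewrite T_sa in h1 h2 *; exact: (@adjB _ V T _ _ h1 h2).
Qed.

Lemma resolvent_rel l x y : nonreal l ->
  T (((resolvent T l (x, y)).1, (resolvent T l (x, y)).2),
     (x + l *: (resolvent T l (x, y)).1, y + l *: (resolvent T l (x, y)).2)).
Proof.
move=> l0; have := @resolventP _ V T l (x, y) saT l0.
by rewrite [resolvent (V := V) _ _ _]surjective_pairing.
Qed.

Lemma resolvent_rel_eq l x y s t : nonreal l ->
  T ((s, t), (x + l *: s, y + l *: t)) -> resolvent T l (x, y) = (s, t).
Proof. by move=> l0 Tst; exact: (@resolvent_eq _ V T l (x, y) (s, t) saT l0). Qed.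

Lemma resolvent_linear l a u v : nonreal l ->
  resolvent T l (0, a *: u + v) = a *: resolvent T l (0, u) + resolvent T l (0, v).
Proof.
move=> l0; rewrite [RHS]surjective_pairing; apply: resolvent_rel_eq => //.
have := rel_lin a (resolvent_rel 0 u l0) (resolvent_rel 0 v l0).
congr (T (_, (_, _))); first by rewrite !add0r scalerDr !scalerA mulrC.
by rewrite !scalerDr !scalerA [a * l]mulrC addrACA.
Qed.

Lemma gamma_rel_linear l : nonreal l -> forall a u v,
  gamma_rel l (a *: u + v) = a *: gamma_rel l u + gamma_rel l v.
Proof. by move=> l0 a u v; rewrite /gamma_rel resolvent_linear. Qed.

Lemma psi_relE l v : nonreal l -> psi_rel l *m v = (resolvent T l (0, v)).2.
Proof.
move=> l0; apply: (@mulmx_linear _ _ (fun v => (resolvent T l (0, v)).2)) => a u v'.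
by rewrite resolvent_linear.
Qed.

Lemma phi_relE l (v : L) : phi_rel l *m v = v + l *: (psi_rel l *m v).
Proof. by rewrite mulmxDl mul1mx -scalemxAl. Qed.

Lemma gamma_relP l v : nonreal l ->
  T ((gamma_rel l v, psi_rel l *m v), (l *: gamma_rel l v, phi_rel l *m v)).
Proof.
move=> l0; have := resolvent_rel 0 v l0.
by rewrite add0r -psi_relE// -phi_relE.
Qed.

(** The common v cancels in the difference of the two elements, and applying T - z to that
    difference leaves (z - w)(x', y'): a resolvent identity in the form of a bound. *)
Lemma rel_bound z w (x x' : Hs) (y y' v : L) :
  T ((x, y), (z *: x, v + z *: y)) -> T ((x', y'), (w *: x', v + w *: y')) ->
  `|complex.Im z| * hnrm (x - x') <= hnrm ((x', y') : V) * cabs (z - w) /\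
  `|complex.Im z| * hnrm (y - y' : hcol R d) <= hnrm ((x', y') : V) * cabs (z - w).
Proof.
move=> h h'.
have hT : T ((x - x', y - y'), (z *: x - w *: x', z *: y - w *: y')).
  by have := rel_sub h h'; rewrite [v + _]addrC addrKA.
have sym := rel_sym hT hT.
have := @sym_bound R V (x - x', y - y') (z *: x - w *: x', z *: y - w *: y') z sym.
have -> : ((z *: x - w *: x', z *: y - w *: y') : V) - z *: ((x - x', y - y') : V) =
    (z - w) *: ((x', y') : V).
  have e (U : lmodType C) (a b : U) : z *: a - w *: b - z *: (a - b) = (z - w) *: b.
    by rewrite scalerBr scalerBl opprB addrC addrA subrK.
  by congr (_, _); exact: e.
rewrite hnrmZ [cabs _ * _]mulrC => h1; split; apply: le_trans h1.
  by rewrite ler_wpM2l//; exact: (@hnrm_fst _ _ _ ((x - x', y - y') : V)).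
by rewrite ler_wpM2l//; exact: (@hnrm_snd _ _ _ ((x - x', y - y') : V)).
Qed.

End Resolvent.

Section NormalizedFamily.
Variables (R : realType) (d : nat) (Hs : hilbert R).
Local Notation C := R[i].
Local Notation L := ('cV[C]_d).
Variable T : set ((Hs * L) * (Hs * L)).
Hypothesis T_sa : selfadjoint_rel (@sum_dot R d Hs) T.
Variables (psi phi : C -> 'M[C]_d) (g : C -> L -> Hs).
Hypothesis phiE : forall l (v : L), phi l *m v = v + l *: (psi l *m v).
Hypothesis gP : forall l v, nonreal l ->
  T ((g l v, psi l *m v), (l *: g l v, phi l *m v)).

Lemma family_form w l u v : nonreal w -> nonreal l ->
  (l - w^*) * hdot Hs (g l u) (g w v) =
  cdot (psi l *m u) (phi w *m v) - cdot (phi l *m u) (psi w *m v).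
Proof.
move=> w0 l0; have := rel_sym T_sa (gP u l0) (gP v w0).
rewrite hdotZl hdotZr; set a := hdot _ _ _; set b := cdot _ _; set c := cdot _ _ => h.
have -> : c = w^* * a + c - w^* * a by ring.
by rewrite -h; ring.
Qed.

Lemma psi_conj l : nonreal l -> psi l^* = (psi l)^t*.
Proof.
move=> l0; apply: cdot_mx_inj => u v; rewrite -cdot_adjl.
have := rel_sym T_sa (gP u (nonreal_conj l0)) (gP v l0).
rewrite hdotZl hdotZr => /addrI; rewrite (phiE l^* u) (phiE l v).
by rewrite cdotDl cdotDr cdotZl cdotZr => /addIr.
Qed.

Lemma phi_conj l : nonreal l -> phi l^* = (phi l)^t*.
Proof.
move=> l0; apply: cdot_mx_inj => u v; rewrite -cdot_adjl (phiE l^* u) (phiE l v).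
by rewrite (psi_conj l0) cdotDl cdotDr cdotZl cdotZr -cdot_adjl.
Qed.

Lemma family_lipschitz l v : nonreal l -> exists c, forall z, nonreal z ->
  `|complex.Im z| * hnrm (g z v - g l v) <= c * cabs (z - l) /\
  `|complex.Im z| * hnrm (psi z *m v - psi l *m v : hcol R d) <= c * cabs (z - l).
Proof.
move=> l0; exists (hnrm ((g l v, psi l *m v) : hsum Hs (hcol R d))) => z z0.
by apply: (rel_bound T_sa (v := v)); rewrite -phiE; exact: gP.
Qed.

Hypothesis g_linear : forall l, nonreal l ->
  forall a u v, g l (a *: u + v) = a *: g l u + g l v.

(** A real shift t keeps Im l, so the increment q - p of psi v is O(t); that of phi v is (l + t)(q -
    p) + t p, again O(t). This feeds the hypothesis [lip] of the model. *)
Lemma family_lipschitz_form l v : nonreal l -> exists B : R, forall n,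
  cabs (cdot (phi (l + (harm R n)%:C%C) *m v - phi l *m v)
             (psi (l + (harm R n)%:C%C) *m v - psi l *m v)) <= B * harm R n ^+ 2.
Proof.
move=> l0; have [c Hc] := family_lipschitz v l0; have y0 := nonreal_gt0 l0.
set y := `|complex.Im l| in y0; pose b := c / y; set p : hcol R d := psi l *m v.
exists (((cabs l + 1) * b + hnrm p) * b) => n; set t := (harm R n)%:C%C.
have n0 := harm_gt0 R n.
have zy : complex.Im (l + t) = complex.Im l by rewrite raddfD /= addr0.
have z0 : nonreal (l + t) by rewrite /nonreal zy.
have tE : cabs (l + t - l) = harm R n.
  by rewrite addrC addKr cabs_real ger0_norm ?harm_ge0.
have [_] := Hc _ z0; rewrite zy -/y tE.
set q : hcol R d := psi (l + t) *m v; set dq := hnrm _ => hq.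
have {hq}hq : dq <= b * harm R n by rewrite /b mulrAC ler_pdivlMr// mulrC.
have dq0 : 0 <= dq := hnrm_ge0 _.
rewrite phiE (phiE l).
have -> : v + (l + t) *: (psi (l + t) *m v) - (v + l *: (psi l *m v)) =
    ((l + t) *: (q - p) + t *: p : hcol R d).
  rewrite opprD addrACA subrr add0r scalerBr -addrA; congr (_ + _).
  by rewrite scalerDl opprD subrK.
have CS := CauchySchwarz_hdot ((l + t) *: (q - p) + t *: p : hcol R d) (q - p).
apply: le_trans CS _; rewrite -/dq.
have h1 : hnrm ((l + t) *: (q - p) + t *: p : hcol R d) <= ((cabs l + 1) * b + hnrm p) * harm R n.
  apply: le_trans (hnrmD _ _) _; rewrite !hnrmZ -/dq cabs_real (ger0_norm (ltW n0)).
  rewrite mulrDl [harm R n * _]mulrC lerD2r.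
  have lt1 : cabs (l + t) <= cabs l + 1.
    apply: le_trans (cabsD _ _) _; rewrite lerD2l cabs_real (ger0_norm (ltW n0)).
    by rewrite /harm invf_le1 ?ltr0n// ler1n.
  apply: (@le_trans _ _ ((cabs l + 1) * dq)); first by rewrite ler_wpM2r.
  by rewrite -mulrA ler_wpM2l// addr_ge0 ?cabs_ge0.
apply: le_trans (ler_wpM2r dq0 h1) _.
rewrite expr2 mulrACA; apply: ler_wpM2l hq.
by apply: le_trans h1; exact: hnrm_ge0.
Qed.

Lemma pair_kernelE w l (u : L) : nonreal w -> nonreal l -> l != w^* ->
  (l - w^*) *: (pair_kernel phi psi w l *m u) =
  psi l *m (phi w^* *m u) - phi l *m (psi w^* *m u).
Proof.
move=> w0 l0 lw; rewrite /pair_kernel -scalemxAl scalerA mulfV ?subr_eq0// scale1r.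
have l'0 := nonreal_conj l0.
by rewrite mulmxBl -!mulmxA -(psi_conj l'0) -(phi_conj l'0) conjCK.
Qed.

Lemma psi_phi_comm l : psi l *m phi l = phi l *m psi l.
Proof.
have -> : phi l = 1%:M + l *: psi l.
  apply: cdot_mx_inj => u v; rewrite phiE mulmxDl mul1mx scalemxAl.
  by [].
by rewrite mulmxDl mulmxDr mul1mx mulmx1 -scalemxAl -scalemxAr.
Qed.

(** The base points are conjugated because the kernel is linear in its dependence on psi(l) and
    phi(l), while l enters the inner product through its conjugate linear argument. *)
Lemma pair_kernel_span w l u v : nonreal w -> nonreal l ->
  cdot (kernel_ext (pair_kernel phi psi) w l *m u) v = hdot Hs (g w^* u) (g l^* v).
Proof.
move=> w0 l0; apply: (kernel_ext_span (G := fun l => g l^*)) => //.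
- by move=> l' /nonreal_conj/g_linear.
- move=> {u v w l w0 l0} w l w0 l0 lw u v.
  rewrite /pair_kernel -scalemxAl mulmxBl -!mulmxA cdotZl cdotBl -!cdot_adjl.
  have := family_form u v (nonreal_conj l0) (nonreal_conj w0); rewrite conjCK.
  have lw0 : l - w^* != 0 by rewrite subr_eq0.
  set a := cdot _ _; set b := cdot (phi _ *m u) _; set c := hdot _ _ _ => h.
  have -> : b - a = (l - w^*) * c by rewrite -opprB -h; ring.
  by rewrite mulKf.
- move=> {u l l0} l v' l0; have [c Hc] := family_lipschitz v' (nonreal_conj l0).
  exists c => z z0; have [+ _] := Hc _ (nonreal_conj z0).
  by rewrite Im_conj normrN -rmorphB /= cabsC.
Qed.

End NormalizedFamily.

(** * Nevanlinna functions from a normalized family *)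

Section WeylFamily.
Variables (R : realType) (d : nat) (Hs : hilbert R).
Local Notation C := R[i].
Local Notation L := ('cV[C]_d).
Variable T : set ((Hs * L) * (Hs * L)).
Hypothesis T_sa : selfadjoint_rel (@sum_dot R d Hs) T.
Variables (m : C -> 'M[C]_d) (g : C -> L -> Hs).
Hypothesis gP : forall l v, nonreal l -> T ((g l v, m l *m v), (l *: g l v, v)).

Lemma weyl_form w l u v : nonreal w -> nonreal l ->
  (l - w^*) * hdot Hs (g l u) (g w v) = cdot (m l *m u) v - cdot u (m w *m v).
Proof.
move=> w0 l0; have := rel_sym T_sa (gP u l0) (gP v w0).
rewrite hdotZl hdotZr; set a := hdot _ _ _; set b := cdot u _; set c := cdot _ _ => h.
have -> : c = w^* * a + c - w^* * a by ring.
by rewrite -h; ring.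
Qed.

Lemma weyl_conj l : nonreal l -> m l^* = (m l)^t*.
Proof.
move=> l0; apply: cdot_mx_inj => u v; rewrite -cdot_adjl.
have := weyl_form u v l0 (nonreal_conj l0).
by rewrite subrr mul0r => /esym/eqP; rewrite subr_eq0 => /eqP.
Qed.

(** The normalization gives both elements the same second entry v in L, so their difference has a
    zero there and [sym_bound] applies in [Hs] alone. *)
Lemma weyl_lipschitz l v : nonreal l -> exists c, forall z, nonreal z ->
  `|complex.Im z| * hnrm (g z v - g l v) <= c * cabs (z - l).
Proof.
move=> l0; exists (hnrm (g l v)) => z z0.
have hT := rel_sub T_sa (gP v z0) (gP v l0).
have := rel_sym T_sa hT hT; rewrite (subrr v) cdot0l cdot0r !addr0 => sym.
have := sym_bound z sym.
have -> : z *: g z v - l *: g l v - z *: (g z v - g l v) = (z - l) *: g l v.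
  by rewrite scalerBr scalerBl opprB addrC addrA subrK.
by rewrite hnrmZ [cabs _ * _]mulrC.
Qed.

Hypothesis g_linear : forall l, nonreal l ->
  forall a u v, g l (a *: u + v) = a *: g l u + g l v.

Lemma nev_kernel_form w l u v : nonreal w -> nonreal l -> l != w^* ->
  cdot (nev_kernel m w l *m u) v = hdot Hs (g w^* u) (g l^* v).
Proof.
move=> w0 l0 lw; rewrite /nev_kernel -scalemxAl mulmxBl cdotZl cdotBl -cdot_adjl.
have := weyl_form u v (nonreal_conj l0) (nonreal_conj w0); rewrite conjCK.
rewrite (weyl_conj w0) -cdot_adjl (weyl_conj l0) -cdot_adjr.
have lw0 : l - w^* != 0 by rewrite subr_eq0.
set a := cdot u _; set b := cdot _ v; set c := hdot _ _ _ => h.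
have -> : b - a = (l - w^*) * c by rewrite -opprB -h; ring.
by rewrite mulKf.
Qed.

Lemma nev_kernel_span w l u v : nonreal w -> nonreal l ->
  cdot (kernel_ext (nev_kernel m) w l *m u) v = hdot Hs (g w^* u) (g l^* v).
Proof.
move=> w0 l0; apply: (kernel_ext_span (G := fun l => g l^*)) => //.
- by move=> l' /nonreal_conj/g_linear.
- by move=> *; exact: nev_kernel_form.
- move=> {u l l0} l v' l0; have [c Hc] := weyl_lipschitz v' (nonreal_conj l0).
  exists c => z z0; have := Hc _ (nonreal_conj z0).
  by rewrite Im_conj normrN -rmorphB /= cabsC.
Qed.

Lemma weyl_holomorphic : holomorphic_nonreal m.
Proof.
move=> z z0 i j; apply/cvg_ex.
exists (hdot Hs (g z (delta_mx j 0)) (g z^* (delta_mx i 0))).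
have [B [r [r0 HB]]] := lipschitz_local weyl_lipschitz (delta_mx j 0) z0.
apply: (lipschitz_dnbhs (B := B * hnrm (g z^* (delta_mx i 0))) r0) => h h0.
rewrite subr0 => hr.
have hz : cabs (h + z - z) < r by rewrite addrK.
have [hz0 Hh] := HB _ hz.
have e : h^-1 * (m (h + z) i j - m z i j) =
    hdot Hs (g (h + z) (delta_mx j 0)) (g z^* (delta_mx i 0)).
  have := weyl_form (delta_mx j 0) (delta_mx i 0) (nonreal_conj z0) hz0.
  rewrite conjCK addrK (weyl_conj z0) -cdot_adjr !cdot_delta !mulmx_delta => <-.
  by rewrite mulKf.
rewrite -[X in cabs (X - _)]/(h^-1 * (m (h * 1 + z) i j - m z i j)) mulr1 e -hdotBl.
apply: le_trans (CauchySchwarz_hdot _ _) _; rewrite mulrAC ler_wpM2r ?hnrm_ge0//.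
by move: Hh; rewrite addrK.
Qed.

Lemma weyl_nonneg : kernel_nonneg [set l | 0 < complex.Im l] (nev_kernel m).
Proof.
move=> n w u wP.
have w0 i : nonreal (w i) by rewrite /nonreal gt_eqF//; exact: wP.
pose f := \sum_i g (w i)^* (u i).
rewrite (_ : \sum_i _ = hdot Hs f f); first exact: hdot_ge0.
rewrite /f (big_morph _ (fun x y => hdotDl x y _) (hdot0l _)); apply: eq_bigr => i _.
rewrite (big_morph _ (fun x y => hdotDr x y _) (hdot0r _)); apply: eq_bigr => j _.
rewrite nev_kernel_form//.
have := wP i; have := wP j => /= wj wi.
by apply/eqP => e; move: wj; rewrite e Im_conj; lra.
Qed.

Lemma weyl_nevanlinna : nevanlinna m.
Proof.
split; [exact: weyl_holomorphic | exact: weyl_conj | exact: weyl_nonneg].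
Qed.

End WeylFamily.

(** * The functional model *)

Section Model.
Variables (R : realType) (d : nat).
Local Notation C := R[i].
Local Notation L := ('cV[C]_d).
Variables (k : C -> C -> 'M[C]_d) (S : rkhs k) (psi phi : C -> 'M[C]_d).
Local Notation V := (hsum S (hcol R d)).
Local Notation adj := (adjoint_rel (hdot V)).
Hypothesis psi_conj : forall l, nonreal l -> psi l^* = (psi l)^t*.
Hypothesis phi_conj : forall l, nonreal l -> phi l^* = (phi l)^t*.
Hypothesis comm : forall l, nonreal l -> psi l *m phi l = phi l *m psi l.
Hypothesis kE : forall w l (u : L), nonreal w -> nonreal l -> l != w^* ->
  (l - w^*) *: (k w l *m u) = psi l *m (phi w^* *m u) - phi l *m (psi w^* *m u).
Hypothesis inj : forall l (u : L), nonreal l -> phi l *m u = l *: (psi l *m u) -> u = 0.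
(* Only the product of the two increments matters: nothing is required of [psi]
   when [phi] is constant. *)
Hypothesis lip : forall l v, nonreal l -> exists B : R, forall n,
  cabs (cdot (phi (l + (harm R n)%:C%C) *m v - phi l *m v)
             (psi (l + (harm R n)%:C%C) *m v - psi l *m v)) <= B * harm R n ^+ 2.

Lemma rk_kernel : exists N : C -> L -> S, forall w u, nonreal w ->
  (forall l, nonreal l -> rk_eval (N w u) l = kernel_ext k w l *m u) /\
  forall f, hdot S f (N w u) = cdot (rk_eval f w) u.
Proof.
have /choice[N HN] (p : C * L) : exists x : S, nonreal p.1 ->
    (forall l, nonreal l -> rk_eval x l = kernel_ext k p.1 l *m p.2) /\
    forall f, hdot S f x = cdot (rk_eval f p.1) p.2.
  case: p => w u /=; have [w0|nw0] := pselect (nonreal w); last by exists 0.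
  by have [x h1 h2] := @rk_reproducing _ _ _ S w u w0; exists x.
by exists (fun w u => N (w, u)) => w u; exact: HN (w, u).
Qed.

Variable N : C -> L -> S.
Hypothesis N_eval : forall w u l, nonreal w -> nonreal l ->
  rk_eval (N w u) l = kernel_ext k w l *m u.
Hypothesis N_rep : forall w u f, nonreal w -> hdot S f (N w u) = cdot (rk_eval f w) u.

(** The kernel function [N l^* v] plays the part that the vector g(l) v has for a selfadjoint
    relation. *)
Definition model_core : set (V * V) := [set e | exists l v, nonreal l /\
  e = ((N l^* v, psi l *m v), (l *: N l^* v, phi l *m v))].

Definition model_rel : set ((S * L) * (S * L)) := adj model_core.

(** Testing against the core element at l^* evaluates at l: the reproducing property handles the
    functions, [psi_conj] and [phi_conj] the matrices. *)
Lemma model_relE (f f' : S) (u v : L) : model_rel ((f, u), (f', v)) <->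
  forall l, nonreal l ->
    rk_eval f' l - l *: rk_eval f l = phi l *m u - psi l *m v.
Proof.
have E l w : nonreal l ->
    (hdot V (f', v) (N l w, psi l^* *m w) = hdot V (f, u) (l^* *: N l w, phi l^* *m w)) <->
    (cdot (rk_eval f' l - l *: rk_eval f l) w = cdot (phi l *m u - psi l *m v) w).
  move=> l0; rewrite -[hdot V _ _]/(hdot S f' (N l w) + cdot v (psi l^* *m w)).
  rewrite -[hdot V (f, u) _]/(hdot S f (l^* *: N l w) + cdot u (phi l^* *m w)).
  rewrite hdotZr conjCK !N_rep// psi_conj// phi_conj// -!cdot_adjr !cdotBl cdotZl.
  set a := cdot _ _; set b := cdot _ _; set a' := cdot _ _; set b' := cdot _ _.
  split=> h.
    by apply/eqP; rewrite -subr_eq0 -(subrr (a + b)) {2}h; apply/eqP; ring.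
  by apply/eqP; rewrite -subr_eq0 -(subrr (a - l * a')) {2}h; apply/eqP; ring.
split=> [h l l0|h e [l [w [l0 ->]]]].
  apply: cdot_inj => w; apply/E => //.
  apply: (h ((N l w, psi l^* *m w), (l^* *: N l w, phi l^* *m w))).
  by exists l^*, w; rewrite conjCK; split=> //; exact: nonreal_conj.
have /(E _ w) := nonreal_conj l0; rewrite conjCK => -[_]; apply.
by rewrite h//; exact: nonreal_conj.
Qed.

Lemma model_core_mem l v : nonreal l ->
  model_core ((N l^* v, psi l *m v), (l *: N l^* v, phi l *m v)).
Proof. by move=> l0; exists l, v. Qed.

Lemma rk_evalZ a f l : nonreal l -> rk_eval (a *: f : S) l = a *: rk_eval f l.
Proof.
move=> l0; have z : rk_eval (0 : S) l = 0.
  have := rk_eval_linear (-1) (0 : S) 0 l0.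
  by rewrite scaler0 addr0 scaleN1r addNr.
by have := rk_eval_linear a f (0 : S) l0; rewrite z !addr0.
Qed.

(** In the form given by [model_relE] this is [kE] when l <> w; when l = w the kernel term carries
    the factor 0 and what remains is [comm]. *)
Lemma model_core_sub : model_core `<=` adj model_core.
Proof.
move=> e [w [v [w0 ->]]]; apply/model_relE => l l0.
have w'0 := nonreal_conj w0.
rewrite rk_evalZ// -scalerBl N_eval//.
have [->|lw] := eqVneq l w.
  by rewrite subrr scale0r !mulmxA comm// subrr.
rewrite /kernel_ext conjCK (negPf lw) -opprB scaleNr.
have := kE v w'0 l0; rewrite conjCK => -> //.
by rewrite opprB.
Qed.

(* The symmetry of [model_core], applied to differences of its elements, gives
   [N (l + t) v --> N l v] as [t --> 0]. *)
Lemma rk_eval_isolated (f : S) l : nonreal l ->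
  (forall z, nonreal z -> z != l -> rk_eval f z = 0) -> rk_eval f l = 0.
Proof.
move=> l0 fz; apply: cdot_inj => v; rewrite cdot0l.
have l'0 := nonreal_conj l0; have y0 := nonreal_gt0 l'0.
have [B HB] := lip v l'0; set y := `|_| in y0.
pose a := (hnrm (N l v)) / y; pose b := `|B| / y.
have a0 : 0 <= a by rewrite divr_ge0 ?hnrm_ge0// ltW.
have b0 : 0 <= b by rewrite divr_ge0// ltW.
apply: (@cabs_eq0_harm _ _ (hnrm f * (a + b + 1))) => n.
pose t := (harm R n)%:C%C; have n0 := harm_gt0 R n.
have t0 : t != 0 by rewrite /t eq_complex /= gt_eqF.
have ty : complex.Im (l^* + t) = complex.Im l^* by rewrite raddfD /= addr0.
have z'0 : nonreal (l^* + t) by rewrite /nonreal ty.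
have zE : (l^* + t)^* = l + t by rewrite rmorphD /= conjCK conjRc.
have z0 : nonreal (l + t) by rewrite -zE; exact: nonreal_conj.
pose X := N (l + t) v - N l v.
(* Since f vanishes at l + t, its value at l is an inner product with the difference [X] of two
   kernel functions. *)
have -> : cdot (rk_eval f l) v = - hdot S f X.
  rewrite hdotBr !N_rep// (fz (l + t))// ?cdot0l ?sub0r ?opprK//.
  by rewrite -subr_eq0 addrC addKr.
rewrite cabsN; apply: le_trans (CauchySchwarz_hdot _ _) _.
rewrite -mulrA ler_wpM2l ?hnrm_ge0//.
have sy : forall e e', model_core e -> model_core e' -> adj model_core (e - e').
  by move=> e e' he he'; apply: adjB; exact: model_core_sub.
have h1 := model_core_mem v z'0; rewrite zE in h1.
have h2 := model_core_mem v l'0; rewrite conjCK in h2.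
set P := psi (l^* + t) *m v - psi l^* *m v.
set Q := phi (l^* + t) *m v - phi l^* *m v.
have D : adj model_core ((X, P), ((l^* + t) *: N (l + t) v - l^* *: N l v, Q)).
  exact: sy h1 h2.
have e1 := D _ h1; have e2 := D _ h2.
have sym : hdot S ((l^* + t) *: N (l + t) v - l^* *: N l v) X + cdot Q P =
           hdot S X ((l^* + t) *: N (l + t) v - l^* *: N l v) + cdot P Q.
  (* Each test pairs the difference with one core element; subtracting the tests pairs it with
     itself. The imaginary part then bounds |Im l| |X|^2. *)
  have := congr2 (fun p q => p - q) e1 e2.
  rewrite -!hdotBr -[LHS]/(hdot S _ X + cdot Q P).
  by move=> ->.
have {sym}sym : y * hnrm X ^+ 2 <= harm R n * (hnrm (N l v) * hnrm X) + `|B| * harm R n ^+ 2.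
  have e : (l^* + t) *: N (l + t) v - l^* *: N l v = (l^* + t) *: X + t *: N l v.
    by rewrite scalerBr !scalerDl opprD !addrA subrK.
  rewrite [hdot S X _]hdotC [cdot P Q]cdotC -rmorphD in sym.
  move: sym => /(congr1 (@complex.Im R)) /=; rewrite Im_conj e hdotDl !hdotZl hnrmE.
  have := HB n; rewrite -/t -/P -/Q => hB.
  set p := hdot S (N l v) X; set q := cdot Q P in hB *.
  have hp : cabs p <= hnrm (N l v) * hnrm X by exact: CauchySchwarz_hdot.
  rewrite -addrA raddfD /= ImM_real ty => h.
  have h' : complex.Im l^* * hnrm X ^+ 2 = - complex.Im (t * p + q) by lra.
  have : y * hnrm X ^+ 2 = `|complex.Im (t * p + q)|.
    by rewrite -normrN -h' normrM [`|_ ^+ 2|]ger0_norm ?sqr_ge0.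
  move=> ->; apply: le_trans (Im_cabs _) _; apply: le_trans (cabsD _ _) _.
  rewrite cabsM cabs_real (ger0_norm (harm_ge0 R n)); apply: lerD.
    by rewrite ler_wpM2l// ltW.
  by apply: le_trans hB _; rewrite ler_wpM2r ?sqr_ge0// ler_norm.
apply: quadratic_le (hnrm_ge0 X) _ => //.
rewrite -(ler_pM2l y0); apply: le_trans sym _.
by rewrite /a /b le_eqVlt; apply/orP; left; apply/eqP; field; rewrite gt_eqF.
Qed.

(** For an eigenvector (f, u) at l, the equation at l itself reads phi u = l psi u, so u = 0 by
    [inj]; the other points then force f = 0 off l, and [rk_eval_isolated] covers l. *)
Lemma model_selfadjoint : selfadjoint_rel (@sum_dot R d S) model_rel.
Proof.
apply: (@essentially_selfadjoint R V); first exact: model_core_sub.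
move=> l l0 [f u] /model_relE h.
have u0 : u = 0.
  have := h l l0; rewrite rk_evalZ// subrr -scalemxAr => /esym/eqP.
  by rewrite subr_eq0 => /eqP; exact: inj.
have fz z : nonreal z -> z != l -> rk_eval f z = 0.
  move=> z0 zl; have := h z z0; rewrite rk_evalZ// u0 scaler0 !mulmx0 subrr -scalerBl.
  by move=> /eqP; rewrite scaler_eq0 subr_eq0 eq_sym (negPf zl) => /eqP.
have fl := rk_eval_isolated l0 fz.
rewrite u0; congr (_, _); apply: (@rk_eval_inj _ _ _ S) => z z0.
have -> : rk_eval (0 : S) z = 0 by rewrite -(scale0r f) rk_evalZ// scale0r.
by have [->|zl] := eqVneq z l; [|exact: fz].
Qed.

End Model.

(** * From a mapping F to an extension *)

Section ModelExtension.
Variables (R : realType) (d : nat) (D : aip_data R d) (H : completion D).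
Local Notation C := R[i].
Local Notation L := ('cV[C]_d).
Local Notation X := (aX D).
Hypothesis hK : aip_identity D.
Variables (k : C -> C -> 'M[C]_d) (S : rkhs k) (psi phi : C -> 'M[C]_d).
Hypothesis psi_conj : forall l, nonreal l -> psi l^* = (psi l)^t*.
Hypothesis phi_conj : forall l, nonreal l -> phi l^* = (phi l)^t*.
Hypothesis comm : forall l, nonreal l -> psi l *m phi l = phi l *m psi l.
Hypothesis kE : forall w l (u : L), nonreal w -> nonreal l -> l != w^* ->
  (l - w^*) *: (k w l *m u) = psi l *m (phi w^* *m u) - phi l *m (psi w^* *m u).
Hypothesis inj : forall l (u : L), nonreal l -> phi l *m u = l *: (psi l *m u) -> u = 0.
Hypothesis lip : forall l v, nonreal l -> exists B : R, forall n,
  cabs (cdot (phi (l + (harm R n)%:C%C) *m v - phi l *m v)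
             (psi (l + (harm R n)%:C%C) *m v - psi l *m v)) <= B * harm R n ^+ 2.
Variable F : {linear X -> S}.
Hypothesis F_eq : forall h l, nonreal l ->
  rk_eval (F (aB2 D h)) l - l *: rk_eval (F (aB1 D h)) l =
  phi l *m aC1 D h - psi l *m aC2 D h.
Hypothesis F_le : forall h, hdot S (F h) (F h) <= aK D h h.

(** The defect form: the part of K that F does not account for, nonnegative by [F_le]. *)
Let K0 (h g : X) : C := aK D h g - hdot S (F h) (F g).

Let K0_bilinear : bilinear_for *%R (conjC \; *%R) K0.
Proof.
split=> [z a x y|z a x y]; rewrite /K0 (linearP F).
  by rewrite linearPl hdotDl hdotZl /=; ring.
by rewrite linearPr hdotDr hdotZr /=; ring.
Qed.

Let K0b : {bilinear X -> X -> C | *%R & (conjC \; *%R)} :=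
  HB.pack K0 (bilinear_isBilinear.Build C X X C *%R (conjC \; *%R) K0 K0_bilinear).

Let hat := cp_hat H.

Lemma hat_dense (x : H) n : exists h, hnrm (x - hat h) <= harm R n.
Proof.
have [|h hx] := @cp_dense _ _ _ H x ((harm R n ^+ 2)%:C%C).
  by rewrite ltcE /= eqxx exprn_gt0// harm_gt0.
exists h; move: hx; rewrite hnrmE ltcR.
by rewrite ltr_pXn2r ?nnegrE ?hnrm_ge0 ?harm_ge0// => /ltW.
Qed.

(** Applying T - l to the core element at l leaves (0, phi u - l psi u), whose resolvent therefore
    has L component psi u; this is the first clause. The second compares the resolvent at F h with
    the core elements. *)
Theorem model_extension : exists T : exit_extension (hat_rel H),
  (forall l (u : L), nonreal l ->
     psi_of T l *m (phi l *m u - l *: (psi l *m u)) = psi l *m u) /\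
  ((forall l (u : L), nonreal l -> phi l *m u - l *: (psi l *m u) = u) ->
   forall h l, nonreal l -> rk_eval (F h) l = F_of T (hat h) l).
Proof.
have [N HN] := rk_kernel S.
have N_eval w u l : nonreal w -> nonreal l -> rk_eval (N w u) l = kernel_ext k w l *m u.
  by move=> w0; have [h _] := HN w u w0; exact: h.
have N_rep w u f : nonreal w -> hdot S f (N w u) = cdot (rk_eval f w) u.
  by move=> w0; have [_ h] := HN w u w0; exact: h.
pose TS := model_rel psi phi N.
have TS_sa : selfadjoint_rel (@sum_dot R d S) TS.
  exact: (model_selfadjoint psi_conj phi_conj comm kE inj lip N_eval N_rep).
have TS_E := model_relE psi_conj phi_conj N_rep.
have TS_core l v : nonreal l -> TS ((N l^* v, psi l *m v), (l *: N l^* v, phi l *m v)).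
  move=> l0; apply: (model_core_sub psi_conj phi_conj comm kE N_eval N_rep).
  exact: model_core_mem.
have TS_B h : TS ((F (aB1 D h), aC1 D h), (F (aB2 D h), aC2 D h)).
  by apply/TS_E => l l0; exact: F_eq.
have [|H0 [j0 [j0_iso _]]] := @psd_completion _ _ K0b.
  by move=> h; rewrite subr_ge0; exact: F_le.
pose A0 : set (H0 * H0) := [set e | exists h, e = (j0 (aB1 D h), j0 (aB2 D h))].
have A0_sym : A0 `<=` adjoint_rel (hdot H0) A0.
  move=> _ [h ->] _ [g ->] /=; rewrite !j0_iso /= /K0.
  have := rel_sym TS_sa (TS_B h) (TS_B g); have := hK h g => e1 e2.
  apply/eqP; rewrite -subr_eq0; apply/eqP.
  (* The identity of the data minus the symmetry of the model leaves the symmetry of the defect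
     form. *)
  move/eqP: e1; rewrite -subr_eq0 => /eqP e1; move/eqP: e2; rewrite -subr_eq0 => /eqP e2.
  rewrite -(subrr 0) -{1}e1 -e2; ring.
have T0_sa := exit_rel_selfadjoint A0_sym.
pose Hs := hsum S (hsum H0 H0).
pose T : set ((Hs * L) * (Hs * L)) := [set e |
  TS ((e.1.1.1, e.1.2), (e.2.1.1, e.2.2)) /\ exit_rel A0 (e.1.1.2, e.2.1.2)].
have T_sa : selfadjoint_rel (@sum_dot R d Hs) T.
  apply/seteqP; split.
    move=> e [e1 e2] g [g1 g2].
    have h1 := rel_sym TS_sa e1 g1.
    have h2 : hdot (hsum H0 H0) e.2.1.2 g.1.1.2 = hdot (hsum H0 H0) e.1.1.2 g.2.1.2.
      by rewrite T0_sa in e2; exact: e2 g2.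
    have Hs_dot (x y : Hs) : hdot Hs x y = hdot S x.1 y.1 + hdot (hsum H0 H0) x.2 y.2 by [].
    rewrite /sum_dot !Hs_dot.
    by rewrite addrAC h1 h2 addrAC.
  move=> e Te.
  have P (f f' : S) (p p' : hsum H0 H0) (u u' : L) :
      TS ((f, u), (f', u')) -> exit_rel A0 (p, p') ->
      hdot S e.2.1.1 f + hdot (hsum H0 H0) e.2.1.2 p + cdot e.2.2 u =
      hdot S e.1.1.1 f' + hdot (hsum H0 H0) e.1.1.2 p' + cdot e.1.2 u'.
    by move=> h1 h2; exact: (Te (((f, p), u), ((f', p'), u'))).
  split.
    rewrite TS_sa => -[[f u] [f' u']] TSf; have := P f f' 0 0 u u' TSf.
    rewrite !hdot0r !addr0; apply.
    by rewrite T0_sa; exact: adj0.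
  rewrite T0_sa => -[p p'] T0p; have := P 0 0 p p' 0 0.
  rewrite !hdot0r !cdot0r !add0r !addr0; apply=> //.
  by rewrite TS_sa; exact: (@adj0 _ (hsum S (hcol R d))).
have J_lin : linear ((fun h => (F h, (j0 h, 0))) : X -> Hs).
  by move=> a x y; rewrite !linearP; congr (_, (_, _)); rewrite /= scaler0 addr0.
pose J := linear_of J_lin.
have J_iso h g : hdot Hs (J h) (J g) = hdot H (hat h) (hat g).
  rewrite cp_isometry -[LHS]/(hdot S (F h) (F g) + (hdot H0 (j0 h) (j0 g) + hdot H0 0 0)).
  by rewrite hdot0l addr0 j0_iso /= /K0 addrC subrK.
have [I [I_hat I_iso]] := extend_isometry hat_dense J_iso.
have T_ext e : hat_rel H e -> T ((I e.1.1, e.1.2), (I e.2.1, e.2.2)).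
  move=> [h ->] /=; rewrite !I_hat; split; first exact: TS_B.
  by apply: exit_rel_extends => //; exists h.
have T_core l v : nonreal l ->
    T (((N l^* v, 0), psi l *m v), ((l *: N l^* v, 0), phi l *m v)).
  by move=> l0; split; [exact: TS_core | rewrite T0_sa; exact: adj0].
exists (ExitExtension I_iso T_sa T_ext); split=> [l u l0|norm h l l0].
  have -> : psi_of (ExitExtension I_iso T_sa T_ext) l = psi_rel T l by [].
  rewrite (psi_relE T_sa)//.
  rewrite (@resolvent_rel_eq _ _ Hs T T_sa l 0 _ (N l^* u, 0) (psi l *m u) l0) //.
  rewrite subrK add0r.
  have := T_core l u l0; congr (T (_, (_, _))); congr (_, _); exact/esym/scaler0.
apply: cdot_inj => v; rewrite -N_rep//.
have := resolvent_rel T_sa (J h) 0 l0; rewrite -I_hat.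
rewrite /F_of /=; set r := resolvent _ _ _ => Tr.
(* Pairing with the core element at l^* cancels the terms in the S component of the resolvent and
   leaves <F h, N l v>, the value of F h at l. *)
have := rel_sym T_sa Tr (T_core l^* v (nonreal_conj l0)).
rewrite conjCK add0r hdotDl cdotZl hdotZl.
rewrite -[hdot Hs r.1 (l^* *: _, 0)]/(hdot S r.1.1 (l^* *: N l v) + hdot (hsum H0 H0) r.1.2 0).
rewrite -[hdot Hs r.1 (N l v, 0)]/(hdot S r.1.1 (N l v) + hdot (hsum H0 H0) r.1.2 0).
rewrite I_hat -[hdot Hs (J h) _]/(hdot S (F h) (N l v) + hdot (hsum H0 H0) (j0 h, 0) 0).
rewrite !hdot0r !addr0 hdotZr conjCK => /eqP.
have := norm l^* v (nonreal_conj l0) => /(congr1 (cdot r.2)).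
rewrite cdotBr cdotZr conjCK => <-.
rewrite addrAC -subr_eq0 => /eqP e; apply/eqP; rewrite -subr_eq0 -e; apply/eqP; ring.
Qed.

End ModelExtension.

(** * The interpolation problem *)

Section AIP.
Variables (R : realType) (d : nat) (D : aip_data R d).
Local Notation C := R[i].
Local Notation L := ('cV[C]_d).

Lemma completion_exists : inhabited (completion D).
Proof.
have [H [j [j_iso j_dense]]] := psd_completion (@aK_ge0 _ _ D).
have dense (x : H) (e : C) : 0 < e -> exists h, hdot H (x - j h) (x - j h) < e.
  move=> e0; have [n he] := harm_lt (sqrt_Re_gt0 e0); have [h hx] := j_dense x n.
  exists h; rewrite (lt_sqr_Re e0 _ (hnrmE _)) ?hnrm_ge0//.
  exact: le_lt_trans hx he.
exact: inhabits (Completion j_iso dense).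
Qed.

Variable H : completion D.

Section Existence.
Hypothesis hK : aip_identity D.

Lemma exit_extension_exists : inhabited (exit_extension (hat_rel H)).
Proof.
pose V := hsum H (hcol R d); pose A : set (V * V) := hat_rel H.
have symA : A `<=` adjoint_rel (hdot V) A.
  move=> _ [h ->] _ [g ->] /=.
  rewrite -[LHS]/(hdot H (cp_hat H (aB2 D h)) (cp_hat H (aB1 D g)) + cdot (aC2 D h) (aC1 D g)).
  rewrite -[RHS]/(hdot H (cp_hat H (aB1 D h)) (cp_hat H (aB2 D g)) + cdot (aC1 D h) (aC2 D g)).
  rewrite !cp_isometry; have := hK h g.
  set a := aK D _ _; set b := aK D _ _; set p := cdot _ _; set q := cdot _ _ => e.
  have -> : a = a - b + b by ring.
  by rewrite e; ring.
(* The doubling lives in (H + L) + (H + L). [U] regroups it so that the first copy of L stays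
   distinguished and the whole second copy joins the exit space. *)
pose Hs := hsum H V.
pose U (e : Hs * L) : hsum V V := ((e.1.1, e.2), e.1.2).
pose T : set ((Hs * L) * (Hs * L)) := [set e | exit_rel A (U e.1, U e.2)].
have UE x y : hdot (hsum V V) (U x) (U y) = @sum_dot R d Hs x y.
  rewrite -[LHS]/(hdot H x.1.1 y.1.1 + cdot x.2 y.2 + hdot V x.1.2 y.1.2).
  rewrite -[RHS]/(hdot H x.1.1 y.1.1 + hdot V x.1.2 y.1.2 + cdot x.2 y.2).
  by rewrite addrAC.
have T_sa : selfadjoint_rel (@sum_dot R d Hs) T.
  have saA := exit_rel_selfadjoint symA.
  apply/seteqP; split=> [e Te g Tg|e Te].
    have Te' : adjoint_rel (hdot (hsum V V)) (exit_rel A) (U e.1, U e.2) by rewrite -saA.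
    by rewrite -!UE; exact: (Te' (U g.1, U g.2)).
  suff : adjoint_rel (hdot (hsum V V)) (exit_rel A) (U e.1, U e.2) by rewrite -saA.
  move=> [[[h u] v] [[h' u'] v']] Tg.
  by have := Te (((h, v), u), ((h', v'), u')) Tg; rewrite -!UE.
have I_lin : linear ((fun h => (h, 0)) : H -> Hs).
  by move=> a x y; congr (_, _); rewrite /= scaler0 addr0.
have I_iso x y : hdot Hs (linear_of I_lin x) (linear_of I_lin y) = hdot H x y.
  rewrite -[LHS]/(hdot H x y + hdot V 0 0); by rewrite hdot0l addr0.
have T_ext e : hat_rel H e ->
    T ((linear_of I_lin e.1.1, e.1.2), (linear_of I_lin e.2.1, e.2.2)).
  by move=> [h ->]; apply: exit_rel_extends => //; exists h.
exact: inhabits (ExitExtension I_iso T_sa T_ext).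
Qed.

End Existence.

(** * The pair, the mapping and the solution given by an extension *)

Section Extension.
Variable T : exit_extension (hat_rel H).

Local Notation rel := (@ex_rel _ _ _ _ T).
Let gam := gamma_rel rel.

Lemma ext_phiE l (v : L) : phi_of T l *m v = v + l *: (psi_of T l *m v).
Proof. exact: phi_relE. Qed.

Lemma ext_gammaP l (v : L) : nonreal l ->
  rel ((gam l v, psi_of T l *m v), (l *: gam l v, phi_of T l *m v)).
Proof. exact: (gamma_relP (ex_selfadjoint T)). Qed.

Lemma ext_gamma_linear l : nonreal l ->
  forall a u v, gam l (a *: u + v) = a *: gam l u + gam l v.
Proof. exact: (gamma_rel_linear (ex_selfadjoint T)). Qed.

Lemma ext_hat h : rel
  ((ex_emb T (cp_hat H (aB1 D h)), aC1 D h), (ex_emb T (cp_hat H (aB2 D h)), aC2 D h)).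
Proof.
exact: (ex_extends T (f := ((cp_hat H (aB1 D h), aC1 D h), (cp_hat H (aB2 D h), aC2 D h)))
  (ex_intro _ h erefl)).
Qed.

(** The resolvents at l and l^* are adjoint to each other, so P_L (T - l)^-1 on the space is the
    adjoint of [gam l^*]. *)
Lemma ext_F_of h l (v : L) : nonreal l ->
  cdot (F_of T (cp_hat H h) l) v = hdot (ex_space T) (ex_emb T (cp_hat H h)) (gam l^* v).
Proof.
move=> l0; have := resolvent_rel (ex_selfadjoint T) (ex_emb T (cp_hat H h)) 0 l0.
rewrite /F_of; set r := resolvent _ _ _ => Tr.
have := rel_sym (ex_selfadjoint T) Tr (ext_gammaP v (nonreal_conj l0)).
rewrite add0r (ext_phiE l^* v) hdotDl cdotDr !hdotZl !cdotZl !hdotZr !cdotZr conjCK.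
set a := hdot _ _ _; set b := hdot _ _ _; set p := cdot _ _; set q := cdot _ _ => e.
have -> : q = l * b + (q + l * p) - l * b - l * p by ring.
by rewrite -e; ring.
Qed.

Lemma ext_lip l (v : L) : nonreal l -> exists B : R, forall n,
  cabs (cdot (phi_of T (l + (harm R n)%:C%C) *m v - phi_of T l *m v)
             (psi_of T (l + (harm R n)%:C%C) *m v - psi_of T l *m v)) <= B * harm R n ^+ 2.
Proof. exact: (family_lipschitz_form (ex_selfadjoint T) ext_phiE ext_gammaP). Qed.

Lemma ext_phi_unit : (forall u : L, exists h, aC2 D h = u) ->
  forall l, nonreal l -> phi_of T l \in unitmx.
Proof.
move=> hC2 l l0; rewrite -unitmx_tr -row_free_unit; apply: inj_row_free => v.
move=> /(congr1 trmx); rewrite trmx0 trmx_mul trmxK => pv.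
rewrite -[v]trmxK; set u := v^T in pv *.
have Tu := ext_gammaP u l0; rewrite pv in Tu.
(* With phi u = 0 the L terms drop out, so (gam, l gam) is a symmetric pair and [sym_bound] forces
   gam = 0. *)
have sym := rel_sym (ex_selfadjoint T) Tu Tu.
rewrite cdot0l cdot0r !addr0 in sym.
have := sym_bound l sym; rewrite subrr hnrm0 pmulr_rle0 ?nonreal_gt0// => g0.
have {}g0 : gam l u = 0 by apply: hnrm_eq0; apply/le_anti; rewrite g0 hnrm_ge0.
suff p0 : psi_of T l *m u = 0.
  by move: pv; rewrite (ext_phiE l u) p0 scaler0 addr0 => ->; rewrite trmx0.
apply: cdot_inj => w; have [h <-] := hC2 w.
have := rel_sym (ex_selfadjoint T) Tu (ext_hat h).
by rewrite g0 scaler0 !hdot0l !add0r !cdot0l.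
Qed.

Lemma ext_pair_map : exists (S : rkhs (pair_kernel (phi_of T) (psi_of T)))
    (F : {linear aX D -> S}),
  pair_map F /\ forall h l, nonreal l -> rk_eval (F h) l = F_of T (cp_hat H h) l.
Proof.
have saT := ex_selfadjoint T.
have [||S [P [PE P_le]]] := @span_rkhs R d (ex_space T)
    (pair_kernel (phi_of T) (psi_of T)) (fun l => gam l^*).
- by move=> l /nonreal_conj/ext_gamma_linear.
- by move=> w l w0 l0 u v; apply: (pair_kernel_span saT ext_phiE ext_gammaP ext_gamma_linear).
pose F : {linear aX D -> S} := P \o (ex_emb T \o cp_hat H).
exists S, F.
have FE h l : nonreal l -> rk_eval (F h) l = F_of T (cp_hat H h) l.
  by move=> l0; apply: cdot_inj => v; rewrite PE// ext_F_of.
split=> //; split=> [h l l0|h]; last first.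
  by apply: le_trans (P_le _) _; rewrite ex_isometry cp_isometry.
apply: cdot_inj => v; rewrite cdotBl cdotZl !PE//.
have l'0 := nonreal_conj l0.
have := rel_sym saT (ext_hat h) (ext_gammaP v l'0).
rewrite (psi_conj saT ext_phiE ext_gammaP l0) (phi_conj saT ext_phiE ext_gammaP l0).
rewrite -!cdot_adjr hdotZr conjCK cdotBl => e.
set a := hdot _ _ _ in e *; set b := hdot _ _ _ in e *.
set p := cdot _ _ in e *; set q := cdot _ _ in e *.
have -> : a = a + p - p by ring.
by rewrite e; ring.
Qed.

(** The pair satisfies phi - l psi = 1, so both clauses of [model_extension] apply: the first
    returns the same psi, the second represents F. *)
Lemma ext_pair_map_converse (hK : aip_identity D)
    (S : rkhs (pair_kernel (phi_of T) (psi_of T))) (F : {linear aX D -> S}) :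
  pair_map F -> exists T' : exit_extension (hat_rel H),
    (forall l, nonreal l -> psi_of T' l = psi_of T l) /\
    forall h l, nonreal l -> rk_eval (F h) l = F_of T' (cp_hat H h) l.
Proof.
move=> [F_eq F_le]; have saT := ex_selfadjoint T.
have norm l (u : L) : nonreal l -> phi_of T l *m u - l *: (psi_of T l *m u) = u.
  by move=> _; rewrite (ext_phiE l u) addrK.
have inj l (u : L) : nonreal l -> phi_of T l *m u = l *: (psi_of T l *m u) -> u = 0.
  by move=> l0 e; rewrite -(norm l u l0) e subrr.
have [T' [h1 h2]] := @model_extension R d D H hK _ S (psi_of T) (phi_of T)
  (psi_conj saT ext_phiE ext_gammaP) (phi_conj saT ext_phiE ext_gammaP)
  (fun l _ => psi_phi_comm ext_phiE l)
  (pair_kernelE saT ext_phiE ext_gammaP) inj ext_lip F F_eq F_le.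
exists T'; split; last exact: h2.
move=> l l0; apply: cdot_mx_inj => u v.
by have := h1 l u l0; rewrite (norm l u l0) => ->.
Qed.

Lemma ext_solution (m : C -> 'M[C]_d) :
  (forall l, nonreal l -> phi_of T l \in unitmx) ->
  (forall l, nonreal l -> m l = psi_of T l *m invmx (phi_of T l)) -> aip_solution D m.
Proof.
move=> phiU mE; have saT := ex_selfadjoint T.
(* Composing with phi^-1 makes the second L entry of the relation v itself, as a Weyl family
   requires. *)
pose g l (v : L) := gam l (invmx (phi_of T l) *m v).
have gP l v : nonreal l -> rel ((g l v, m l *m v), (l *: g l v, v)).
  move=> l0; have := ext_gammaP (invmx (phi_of T l) *m v) l0.
  by rewrite !mulmxA -(mE l l0) (mulmxV (phiU l l0)) mul1mx.
have g_lin l : nonreal l -> forall a u v, g l (a *: u + v) = a *: g l u + g l v.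
  by move=> l0 a u v; rewrite /g mulmxDr -scalemxAr (ext_gamma_linear l0).
split; first exact: (weyl_nevanlinna saT gP).
have [||S [P [PE P_le]]] := @span_rkhs R d (ex_space T) (nev_kernel m) (fun l => g l^*).
- by move=> l /nonreal_conj/g_lin.
- by move=> w l w0 l0 u v; apply: (nev_kernel_span saT gP g_lin).
pose F : {linear aX D -> S} := P \o (ex_emb T \o cp_hat H).
exists S, F; split=> [h l l0|h]; last first.
  by apply: le_trans (P_le _) _; rewrite ex_isometry cp_isometry.
rewrite mul_row_col mul1mx mulNmx.
apply: cdot_inj => v; rewrite !cdotBl cdotZl !PE//.
have := rel_sym saT (ext_hat h) (gP l^* v (nonreal_conj l0)).
rewrite (weyl_conj saT gP l0) -!cdot_adjr hdotZr conjCK => e.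
set a := hdot _ _ _ in e *; set b := hdot _ _ _ in e *.
set p := cdot _ _ in e *; set q := cdot _ _ in e *.
have -> : a = a + p - p by ring.
by rewrite e; ring.
Qed.

End Extension.

(** For such u the kernel at (l, l) gives -|u|^2 / |l|^2, yet it is the squared norm of a kernel
    function. This is [inj] for the pair {1, m}. *)
Lemma nev_kernel_inj (m : C -> 'M[C]_d) (S : rkhs (nev_kernel m)) l (u : L) :
  nonreal l -> u = l *: (m l *m u) -> u = 0.
Proof.
move=> l0 e; have [N HN] := rk_kernel S; have [N1 N2] := HN l u l0.
have := hdot_ge0 (N l u); rewrite N2 N1// /kernel_ext.
have ll : l != l^*.
  apply/eqP => /(congr1 (@complex.Im R)); rewrite Im_conj => h.
  by move: l0; rewrite /nonreal => /eqP; apply; lra.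
rewrite (negPf ll) /nev_kernel -scalemxAl mulmxBl cdotZl cdotBl -cdot_adjl.
rewrite [cdot u _]cdotC; set c := cdot _ _.
have lN0 : l != 0 by apply: contraTneq l0 => ->; rewrite /nonreal /= eqxx.
have lcN0 : l^* != 0 by rewrite conjC_eq0.
have cE : c = l^-1 * cdot u u by rewrite {1}e cdotZl mulKf.
have rE : (cdot u u)^* = cdot u u by rewrite -cdotC.
have dN0 : l - l^* != 0 by rewrite subr_eq0.
rewrite cE rmorphM /= rE fmorphV => h.
have : 0 <= - (cdot u u / (l * l^*)).
  by move: h; congr (0 <= _); field; rewrite lN0 lcN0 dN0.
have ll0 : 0 < l * l^* by rewrite mul_conjC_gt0.
rewrite oppr_ge0 pmulr_lle0 ?invr_gt0// => uu.
apply/eqP; rewrite -(dnorm_eq0 (hdot (hcol R d))); apply/eqP/le_anti.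
by apply/andP; split; [exact: uu | exact: (@hdot_ge0 _ (hcol R d))].
Qed.

(** The model of {1, m} gives psi (1 - l m) = m, hence phi (1 - l m) = 1, and eliminating 1 - l m
    leaves m = psi phi^-1. *)
Lemma solution_ext (hK : aip_identity D) (m : C -> 'M[C]_d) :
  aip_solution D m -> exists T : exit_extension (hat_rel H), forall l, nonreal l ->
    phi_of T l \in unitmx -> m l = psi_of T l *m invmx (phi_of T l).
Proof.
move=> [[_ m_conj _] [S [F [F_eq F_le]]]].
have kE w l (u : L) : nonreal w -> nonreal l -> l != w^* ->
    (l - w^*) *: (nev_kernel m w l *m u) =
    m l *m (1%:M *m u) - 1%:M *m (m w^* *m u).
  move=> w0 l0 lw; rewrite /nev_kernel -scalemxAl scalerA mulfV ?subr_eq0// scale1r.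
  by rewrite mulmxBl !mul1mx (m_conj w w0).
have F_eq' h l : nonreal l -> rk_eval (F (aB2 D h)) l - l *: rk_eval (F (aB1 D h)) l =
    1%:M *m aC1 D h - m l *m aC2 D h.
  by move=> l0; rewrite (F_eq h l l0) mul_row_col mulNmx.
have one_conj : (1%:M : 'M[C]_d) = (1%:M)^t* by rewrite trmx1 map_mx1.
have lip l (v : L) : nonreal l -> exists B : R, forall n,
    cabs (cdot (1%:M *m v - 1%:M *m v) (m (l + (harm R n)%:C%C) *m v - m l *m v))
      <= B * harm R n ^+ 2.
  by move=> _; exists 0 => n; rewrite subrr cdot0l cabs0 mul0r.
have inj l (u : L) : nonreal l -> 1%:M *m u = l *: (m l *m u) -> u = 0.
  by rewrite mul1mx; exact: nev_kernel_inj.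
have [T [h _]] := @model_extension R d D H hK _ S m (fun=> 1%:M) m_conj
  (fun _ _ => one_conj) (fun l _ => etrans (mulmx1 _) (esym (mul1mx _))) kE inj lip F F_eq' F_le.
exists T => l l0 pU.
have psiE : psi_of T l *m (1%:M - l *: m l) = m l.
  apply: cdot_mx_inj => u v; have := h l u l0.
  by rewrite mul1mx -mulmxA mulmxBl mul1mx -scalemxAl => ->.
have phi1 : phi_of T l *m (1%:M - l *: m l) = 1%:M.
  by rewrite mulmxDl mul1mx -scalemxAl psiE subrK.
by rewrite -{1}psiE -[1%:M - _](mulKmx pU) phi1 mulmx1.
Qed.

End AIP.

(** Invertibility is a clause of its own because [invmx] returns a singular matrix unchanged. The
    completion is quantified over, being unique only up to a unitary operator. *)
Theorem theorem1 (R : realType) (d : nat) (D : aip_data R d)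
    (hK : aip_identity D)
    (hC2 : forall u : 'cV[R[i]]_d, exists h, aC2 D h = u) :
  (exists m, aip_solution D m) /\
  forall H : completion D,
    (forall (T : exit_extension (hat_rel H)) (l : R[i]), nonreal l ->
       phi_of T l \in unitmx) /\
    (forall m : R[i] -> 'M[R[i]]_d,
       aip_solution D m <->
       exists T : exit_extension (hat_rel H), forall l, nonreal l ->
         col_mx (m l) 1%:M =
         block_mx 1%:M 0 (l%:M) 1%:M *m col_mx (psi_of T l) 1%:M
           *m invmx (1%:M + l *: psi_of T l)) /\
    (forall T : exit_extension (hat_rel H),
       exists (S : rkhs (pair_kernel (phi_of T) (psi_of T)))
              (F : {linear aX D -> S}),
         pair_map F /\
         forall h l, nonreal l -> rk_eval (F h) l = F_of T (cp_hat H h) l) /\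
    (forall (T : exit_extension (hat_rel H))
            (S : rkhs (pair_kernel (phi_of T) (psi_of T)))
            (F : {linear aX D -> S}),
       pair_map F ->
       exists T' : exit_extension (hat_rel H),
         (forall l, nonreal l -> psi_of T' l = psi_of T l) /\
         forall h l, nonreal l -> rk_eval (F h) l = F_of T' (cp_hat H h) l).
Proof.
have phiU (H : completion D) (T : exit_extension (hat_rel H)) := @ext_phi_unit R d D H T hC2.
split.
  have [H] := completion_exists D; have [T] := exit_extension_exists H hK.
  exists (fun l => psi_of T l *m invmx (phi_of T l)).
  by apply: (@ext_solution R d D H T) => //; exact: phiU.
move=> H; split; first exact: phiU.
split; last first.
  by split=> [T|T S F]; [exact: ext_pair_map | exact: ext_pair_map_converse].
move=> m.
(* The lower block l psi + 1 is phi, so the second row of the formula is the identity and only m =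
   psi phi^-1 remains. *)
have E (T : exit_extension (hat_rel H)) l : nonreal l ->
    block_mx 1%:M 0 (l%:M) 1%:M *m col_mx (psi_of T l) 1%:M *m invmx (1%:M + l *: psi_of T l) =
    col_mx (psi_of T l *m invmx (phi_of T l)) 1%:M.
  move=> l0; rewrite mul_block_col mul_col_mx !mul1mx mul0mx addr0 mul_scalar_mx.
  by rewrite -[1%:M + _]/(phi_of T l) [_ + 1%:M]addrC -[1%:M + _]/(phi_of T l) mulmxV// phiU.
split=> [sol|[T HT]].
  have [T HT] := solution_ext H hK sol; exists T => l l0; rewrite E//.
  by rewrite -HT// phiU.
apply: (@ext_solution R d D H T); first exact: phiU.
by move=> l l0; have := HT l l0; rewrite E// => /eq_col_mx[].
Qed.
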